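(* Suppose the fine-grid time-stepping operator is $\Phi = {\cal M}_{p,p}^{(\delta t, {\rm fine})}$ and the coarse-grid time-stepping operator is $\Psi = {\cal M}_{p,p}^{(m \delta t, {\rm coarse})}$, where both use the same order-$p$ upwind finite-difference spatial discretization ${\cal L}_p$ (with error constant $\widehat{e}_{\rm FD}$), but possibly different Runge-Kutta methods of order $p$, whose error constants are denoted by $\widehat{e}_{\rm RK}^{\rm \,(fine)}$ and $\widehat{e}_{\rm RK}^{\rm \,(coarse)}$, respectively. Suppose that $p$ is odd. Let $c = \frac{\alpha \delta t}{h}$ be the fine-grid CFL number, and $m$ the coarsening factor. Then the two-level MGRIT convergence factor $\rho({\cal E})$ satisfies the following lower bound, independent of the number of CF-relaxations $\nu \in \mathbb{N}_0$: $$ \rho({\cal E}) \geq \rho \bigg( \widehat{{\cal E}} \bigg(\omega, \theta = - \frac{\omega \alpha \delta t}{h} \bigg) \bigg) \bigg|_{\omega = {\cal O}(h)} = \check{\rho}_p ( c ) \left( 1 + {\cal O} \left(h, \delta t, \delta t \left(\frac{\delta t}{h} \right)^{p}, \delta t \left( \frac{\delta t}{h} \right)^{p+1} \right) \right), $$ where the function $\check{\rho}_p ( c )$ is $$ \check{\rho}_p ( c ) := c^p \left| \frac{\widehat{e}_{\rm RK}^{\rm \,(fine)} - m^p \, \widehat{e}_{\rm RK}^{\rm \,(coarse)}} {\widehat{e}_{\rm FD} + (mc)^p \, \widehat{e}_{\rm RK}^{\rm \,(coarse)}} \right|. $$ In addition, asymptotically in the coarse-grid CFL number $m c$, $\check{\rho}_p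 ( c )$ satisfies $$ \check{\rho}_p ( c ) = \begin{cases} \displaystyle{ \left| 1 - \frac{1}{m^p} \frac{\widehat{e}_{\rm RK}^{\rm \,(fine)}}{\widehat{e}_{\rm RK}^{\rm \,(coarse)}} \right| + {\cal O} \left( \frac{1}{(mc)^p} \right) } \quad &\text{for } m c \gg 1 \ (\text{i.e. as } mc\to\infty), \\[3ex] {\cal O}\big( (mc )^p \big) \quad &\text{for } m c \ll 1 \ (\text{i.e. as } mc\to 0). \end{cases} $$
   Context: **PDE and mesh.** The model problem is $\partial_t u + \alpha\, \partial_x u = 0$ for $(x,t) \in (-1,1)\times(0,T]$, $u(x,0)=u_0(x)$, with constant $\alpha>0$ and periodic boundary conditions in space. The spatial mesh is $x_i = -1+(i-1)h$, $i=1,\dots,n_x$ (so $h = 2/n_x$), and the time mesh is $t_n = n\,\delta t$. **Spatial discretization.** For $p\in\mathbb{N}$, ${\cal L}_p \in \mathbb{R}^{n_x\times n_x}$ is the circulant matrix such that $\frac{1}{h}({\cal L}_p \bm{v})_i$ is the derivative at $x_i$ of the polynomial of degree at most $p$ interpolating the periodic grid function $\bm v$ at the $p+1$ points $\{x_i + jh\}_{j=-\ell(p)}^{r(p)}$. The stencil is upwind-biased: $\ell(p)=\frac{p+1}{2}$, $r(p)=\ell(p)-1$ for odd $p$; $\ell(p)=\frac p2+1$, $r(p)=\ell(p)-2$ for even $p$. Its error constant is $\widehat e_{\rm FD} := (-1)^{r(p)}\frac{\ell(p)!\,r(p)!}{(p+1)!}$. **Temporal discretization.** The Runge-Kutta methods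 are explicit (ERK) or A-stable singly diagonally implicit (SDIRK) of order $q\in\mathbb{N}$, with rational stability function $R_q(z)$ (a polynomial for ERK) having Taylor expansion $R_q(z) = \sum_{j=0}^q \frac{z^j}{j!} + \sum_{j=q+1}^\infty \beta_j z^j$, with $\beta_{q+1}\neq \frac{1}{(q+1)!}$. The error constant is $\widehat e_{\rm RK} := \beta_{q+1}-\frac{1}{(q+1)!}$, which is nonzero. **Method-of-lines operator.** ${\cal M}_{p,q}^{(\delta t)} := R_q\big(-\alpha\,\delta t\,\frac{{\cal L}_p}{h}\big)\in\mathbb{R}^{n_x\times n_x}$. The superscripts ''fine''/''coarse'' indicate which Runge-Kutta method is used; the coarse operator uses time step $m\,\delta t$. **MGRIT convergence factors.** $m\in\mathbb{N}\setminus\{1\}$ is the coarsening factor and $\nu\in\mathbb{N}_0$ is the number of fine-grid CF-relaxation sweeps. For $\omega\in[-\pi,\pi)$, $\lambda(\omega)$ and $\mu(\omega)$ denote the Fourier symbols (eigenvalues) of $\Phi$ and $\Psi$, respectively, associated with the spatial Fourier mode with components $e^{\mathrm{i}\omega x_j/h}$. Let $\Theta^{\rm low} := [-\frac{\pi}{m},\frac{\pi}{m})$. The two-level convergence factor of the space-time mode $(\omega,\theta)$ is defined by $$\rho\big(\widehat{\cal E}(\omega,\theta)\big) = |\lambda(\omega)|^{m\nu}\,\frac{|\lambda^m(\omega)-\mu(\omega)|}{|1-e^{-\mathrm{i}m\theta}\mu(\omega)|},\qquad (\omega,\theta)\in[-\pi,\pi)\times\Theta^{\rm low},$$ and the overall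 two-level MGRIT convergence factor is $$\rho({\cal E}) := \max_{(\omega,\theta)\in[-\pi,\pi)\times\Theta^{\rm low}} \rho\big(\widehat{\cal E}(\omega,\theta)\big),$$ where $\omega=0$ (for which $\lambda=\mu=1$) is omitted. **Asymptotic notation.** The modes with $\omega={\cal O}(h)$ (''asymptotically smooth'') are those with $\omega \neq 0$ of size proportional to $h$ as $h\to0$ (the smoothest nonzero frequencies on the mesh); those with additionally $\theta = -\omega\alpha\,\delta t/h$ are the asymptotically smooth characteristic components, for which $\theta={\cal O}(\delta t)$. ${\cal O}(a,b,\dots)$ means ${\cal O}(a)+{\cal O}(b)+\cdots$, as $h,\delta t\to 0$.
   Formalization: The expansion with factor 1+O(...) is stated only when the fine RK error constant differs from m^p times the coarse one and the denominator of rho-check stays at least some fixed delta > 0 in modulus; the O-constants depend on delta and may depend on nu. *)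

(* Defs.v *)
From HB Require Import structures.
From mathcomp Require Import all_boot all_order all_algebra.
From mathcomp Require Import all_classical all_reals all_analysis.
From mathcomp Require Import complex ring.

Set Implicit Arguments.
Unset Strict Implicit.
Unset Printing Implicit Defensive.
Import Order.TTheory GRing.Theory Num.Theory.
Import numFieldNormedType.Exports.
Local Open Scope ring_scope.

(* Number of stencil points to the left and to the right of x_i; the
   meaningful range is p >= 1. *)
Definition ell (p : nat) : nat :=
  if odd p then (p.+1)./2 else (p./2).+1.
Definition arr (p : nat) : nat :=
  if odd p then (ell p).-1 else (ell p).-2.

Definition err_FD (R : realType) (p : nat) : R :=
  (-1) ^+ arr p * ((ell p)`! * (arr p)`!)%:R / (p.+1)`!%:R.

(* The k-th node x + j h, with the stencil offset j = k - ell p. *)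
Definition fd_node (K : fieldType) (p : nat) (x h : K) (k : nat) : K :=
  x + (k%:Z - (ell p)%:Z)%:~R * h.

(* The polynomial of degree at most p taking the value v j at x + j h for
   j = - ell p, ..., arr p. *)
Definition fd_interp (K : fieldType) (p : nat) (x h : K) (v : int -> K) :
    {poly K} :=
  \sum_(k < p.+1) v (k%:Z - (ell p)%:Z) *:
    (tnth (p.+1.-lagrange (fd_node p x h)) k : {poly K}).

Definition fd_deriv (K : fieldType) (p : nat) (x h : K) (v : int -> K) : K :=
  (fd_interp p x h v)^`().[x].

(* The periodic mesh has n_x = n.+1 points, which makes 'I_n.+1 inhabited;
   points are numbered from 0. *)
Definition mesh_width (R : realType) (n : nat) : R := 2 / n.+1%:R.

Definition mesh_point (R : realType) (n : nat) (i : nat) : R :=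
  -1 + i%:R * mesh_width R n.

(* Index i + j of the periodic mesh, for an offset j of either sign. *)
Definition per_idx (n : nat) (i : 'I_n.+1) (j : int) : 'I_n.+1 :=
  inord `|((i%:Z + j) %% n.+1%:Z)%Z|%N.

(* Column k of L_p is the image of the k-th unit grid function. *)
Definition fd_mx (R : realType) (p n : nat) : 'M[R]_n.+1 :=
  \matrix_(i, k) (mesh_width R n *
    fd_deriv p (mesh_point R n i) (mesh_width R n)
      (fun j => (per_idx i j == k)%:R)).

(* Butcher coefficients; the abscissae play no role for an autonomous problem. *)
Record rk_method (R : realType) := RKMethod {
  rk_stages : nat;
  rk_A : 'M[R]_rk_stages;
  rk_b : 'cV[R]_rk_stages }.

(* Stability function 1 + z b^T (I - z A)^-1 1
     = det (I - z A + z 1 b^T) / det (I - z A). *)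
Definition rk_num (R : realType) (M : rk_method R) : {poly R} :=
  \det (1%:M - 'X *: map_mx polyC (rk_A M - const_mx 1 *m (rk_b M)^T)).
Definition rk_den (R : realType) (M : rk_method R) : {poly R} :=
  \det (1%:M - 'X *: map_mx polyC (rk_A M)).

Definition rk_stab (R : realType) (M : rk_method R) (z : R[i]) : R[i] :=
  (map_poly (real_complex R) (rk_num M)).[z] /
  (map_poly (real_complex R) (rk_den M)).[z].

(* Taylor coefficients at 0; they are real, so the restriction of the
   stability function to the real axis determines them. *)
Definition rk_taylor (R : realType) (M : rk_method R) (j : nat) : R :=
  derive1n j (fun x : R => (rk_num M).[x] / (rk_den M).[x]) 0 / j`!%:R.

Definition rk_explicit (R : realType) (M : rk_method R) : Prop :=
  forall i j : 'I_(rk_stages M), (i <= j)%N -> rk_A M i j = 0.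

Definition rk_sdirk (R : realType) (M : rk_method R) : Prop :=
  is_trig_mx (rk_A M) /\ exists gamma : R, forall i, rk_A M i i = gamma.

Definition rk_A_stable (R : realType) (M : rk_method R) : Prop :=
  forall z : R[i], complex.Re z <= 0 ->
    (map_poly (real_complex R) (rk_den M)).[z] != 0 /\ `|rk_stab M z| <= 1.

(* Order as seen by the linear problem at hand, together with a nonzero error
   constant; the nonlinear order conditions play no role. *)
Definition rk_order (R : realType) (M : rk_method R) (q : nat) : Prop :=
  (forall j, (j <= q)%N -> rk_taylor M j = (j`!%:R)^-1) /\
  rk_taylor M q.+1 <> ((q.+1)`!%:R)^-1.

Definition err_RK (R : realType) (M : rk_method R) (q : nat) : R :=
  rk_taylor M q.+1 - ((q.+1)`!%:R)^-1.

Definition mol_arg (R : realType) (p n : nat) (alpha dt : R) : 'M[R]_n.+1 :=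
  - (alpha * dt / mesh_width R n) *: fd_mx R p n.
Definition mol_mx (R : realType) (p n : nat) (M : rk_method R)
    (alpha dt : R) : 'M[R]_n.+1 :=
  horner_mx (mol_arg p n alpha dt) (rk_num M) *m
  invmx (horner_mx (mol_arg p n alpha dt) (rk_den M)).

Definition cis (R : realType) (t : R) : R[i] := Complex (cos t) (sin t).

Definition fourier_mode (R : realType) (n : nat) (w : R) : 'cV[R[i]]_n.+1 :=
  \col_(j < n.+1) cis (w * mesh_point R n j / mesh_width R n).

(* Symbol of L_p at an arbitrary frequency. The factor e^{i w x_i / h} common
   to all values of the mode and the mesh width h both scale out, leaving the
   interpolation at x = 0 on the unit mesh; compare fd_mx_mode below. *)
Definition fd_symbol (R : realType) (p : nat) (w : R) : R[i] :=
  fd_deriv p 0 1 (fun j : int => cis (w * j%:~R)).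

Definition mol_symbol (R : realType) (p : nat) (M : rk_method R)
    (alpha dt h w : R) : R[i] :=
  rk_stab M (real_complex R (- (alpha * dt / h)) * fd_symbol p w).

(* Convergence factor of the mode (w, theta). It is extended-real valued: the
   inverse of 0 is +oo, so a vanishing denominator is not masked. *)
Definition rho_mode (R : realType) (p m nu : nat) (fine coarse : rk_method R)
    (alpha dt h w theta : R) : \bar R :=
  let lam := mol_symbol p fine alpha dt h w in
  let mu := mol_symbol p coarse alpha (m%:R * dt) h w in
  ((complex.Re `|lam| ^+ (m * nu) * complex.Re `|lam ^+ m - mu|)%:E /
   (complex.Re `|1 - cis (- (m%:R * theta)) * mu|)%:E)%E.

(* The maximum over a half-open, punctured set of frequencies is rendered as a
   supremum in the extended reals. *)
Definition rho_E (R : realType) (p m nu : nat) (fine coarse : rk_method R)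
    (alpha dt h : R) : \bar R :=
  ereal_sup [set r | exists w theta : R,
    [/\ - pi <= w < pi, w != 0, - (pi / m%:R) <= theta < pi / m%:R
      & r = rho_mode p m nu fine coarse alpha dt h w theta]]%classic.

Definition rho_check (R : realType) (p m : nat) (fine coarse : rk_method R)
    (c : R) : R :=
  c ^+ p * `| (err_RK fine p - m%:R ^+ p * err_RK coarse p) /
              (err_FD R p + (m%:R * c) ^+ p * err_RK coarse p) |.

Lemma fd_node_inj (K : numFieldType) (p : nat) (x h : K) :
  h != 0 -> injective (fd_node p x h).
Proof.
move=> h0 a b /addrI/(mulIf h0)/intr_inj /(congr1 (+%R^~ (ell p)%:Z)).
by rewrite !subrK => -[].
Qed.

Lemma fd_deriv_unique (K : numFieldType) (p : nat) (x h : K) (v : int -> K)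
    (P : {poly K}) : h != 0 -> (size P <= p.+1)%N ->
  (forall k : 'I_p.+1, P.[fd_node p x h k] = v (k%:Z - (ell p)%:Z)) ->
  fd_deriv p x h v = P^`().[x].
Proof.
move=> h0 sP Pv; congr (_^`()).[x].
have inj := fd_node_inj (p := p) (x := x) h0.
rewrite [RHS](@lagrange_gen _ p.+1 (fd_node p x h)) // /fd_interp.
by apply: eq_bigr => k _; rewrite Pv mul_polyC.
Qed.

Lemma fd_derivE (K : fieldType) (p : nat) (x h : K) (v : int -> K) :
  fd_deriv p x h v = \sum_(k < p.+1) v (k%:Z - (ell p)%:Z) *
    (tnth (p.+1.-lagrange (fd_node p x h)) k : {poly K})^`().[x].
Proof.
rewrite /fd_deriv /fd_interp raddf_sum horner_sum; apply: eq_bigr => k _ /=.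
by rewrite derivZ hornerZ.
Qed.

Lemma fd_mx_mul (R : realType) (p n : nat) (v : 'cV[R]_n.+1) (i : 'I_n.+1) :
  (fd_mx R p n *m v) i 0 = mesh_width R n *
    fd_deriv p (mesh_point R n i) (mesh_width R n)
      (fun j => v (per_idx i j) 0).
Proof.
rewrite mxE fd_derivE mulr_sumr.
under eq_bigr => k _ do rewrite mxE fd_derivE -mulrA mulr_suml mulr_sumr.
rewrite exchange_big /=; apply: eq_bigr => k _.
rewrite (bigD1 (per_idx i (k%:Z - (ell p)%:Z))) //= eqxx mul1r big1 ?addr0.
  by rewrite [X in _ * X]mulrC.
by move=> j /negPf; rewrite eq_sym => ->; rewrite !mul0r mulr0.
Qed.

Lemma lagr_unique (K : numFieldType) (p : nat) (x h : K) (s : 'I_p.+1)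
    (P : {poly K}) : h != 0 -> (size P <= p.+1)%N ->
  (forall k : 'I_p.+1, P.[fd_node p x h k] = (s == k)%:R) ->
  (tnth (p.+1.-lagrange (fd_node p x h)) s : {poly K}) = P.
Proof.
move=> h0 sP Pv; have inj := fd_node_inj (p := p) (x := x) h0.
rewrite [RHS](@lagrange_gen _ p.+1 (fd_node p x h)) //.
rewrite (bigD1 s) //= Pv eqxx mul1r big1 ?addr0 // => k /negPf.
by rewrite eq_sym => ks; rewrite Pv ks mul0r.
Qed.

Lemma lagr_scale (K : numFieldType) (p : nat) (x h : K) (s : 'I_p.+1) :
  h != 0 ->
  h * (tnth (p.+1.-lagrange (fd_node p x h)) s : {poly K})^`().[x] =
  (tnth (p.+1.-lagrange (fd_node p 0 1)) s : {poly K})^`().[0].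
Proof.
move=> h0.
have -> : (tnth (p.+1.-lagrange (fd_node p 0 1)) s : {poly K}) =
    (tnth (p.+1.-lagrange (fd_node p x h)) s : {poly K}) \Po (h *: 'X + x%:P).
  apply: lagr_unique; first exact: oner_neq0.
    apply: leq_trans (size_comp_poly_leq _ _) _.
    rewrite size_lagrange_ //=; last exact: fd_node_inj.
    by rewrite ltnS -[leqRHS]muln1 leq_mul // -subn1 leq_subLR
       (leq_trans (size_polyD _ _)) // geq_max (leq_trans (size_scale_leq _ _))
       ?size_polyX // (leq_trans (size_polyC_leq1 _)).
  move=> k; rewrite horner_comp !hornerE.
  have -> : h * fd_node p 0 1 k + x = fd_node p x h k.
    by rewrite /fd_node add0r mulr1 addrC mulrC.
  by rewrite lagrange_sample //; exact: fd_node_inj.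
by rewrite deriv_comp derivD derivZ derivX derivC hornerM horner_comp !hornerE
  mulrC.
Qed.

Lemma lagr_map (R : realType) (p : nat) (s : 'I_p.+1) :
  real_complex R
    (tnth (p.+1.-lagrange (fd_node p 0 1)) s : {poly R})^`().[0] =
  (tnth (p.+1.-lagrange (fd_node p 0 1)) s : {poly R[i]})^`().[0].
Proof.
have -> : (tnth (p.+1.-lagrange (fd_node p 0 1)) s : {poly R[i]}) =
    map_poly (real_complex R)
     (tnth (p.+1.-lagrange (fd_node p 0 1)) s : {poly R}).
  apply: lagr_unique; first exact: oner_neq0.
    rewrite size_map_poly size_lagrange_ //; exact/fd_node_inj/oner_neq0.
  move=> k; have -> : fd_node p 0 1 k = real_complex R (fd_node p 0 1 k).
    by rewrite /fd_node !add0r !mulr1 rmorph_int.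
  rewrite horner_map lagrange_sample ?rmorph_nat //.
  exact/fd_node_inj/oner_neq0.
by rewrite deriv_map -(rmorph0 (real_complex R)) horner_map.
Qed.

Lemma cisD (R : realType) (x y : R) : cis (x + y) = cis x * cis y.
Proof.
apply/eqP; rewrite eq_complex /= cosD sinD eqxx /=.
by apply/eqP; rewrite addrC.
Qed.

Lemma cis_per (R : realType) (x : R) (k : int) :
  cis (x + k%:~R * (pi *+ 2)) = cis x.
Proof.
have pern (y : R) (n : nat) : cis (y + n%:R * (pi *+ 2)) = cis y.
  rewrite mulr_natl /cis; congr Complex.
    exact: (periodicn (@cosD2pi R)).
  exact: (periodicn (@sinD2pi R)).
case: k => n; first exact: pern.
rewrite NegzE -[LHS](pern _ n.+1); congr cis.
by rewrite mulrNz mulNr subrK.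
Qed.

Lemma mode_shift (R : realType) (n : nat) (w : R) (k : int) (i : 'I_n.+1)
    (j : int) : w * n.+1%:R = k%:~R * (pi *+ 2) ->
  fourier_mode n w (per_idx i j) 0 = cis (w * j%:~R) * fourier_mode n w i 0.
Proof.
move=> wk; rewrite !mxE -cisD.
pose q : int := ((i%:Z + j) %/ n.+1%:Z)%Z.
have h0 : mesh_width R n != 0 by rewrite mulf_neq0 ?invr_neq0 ?pnatr_eq0.
have lt0 : (0 <= (i%:Z + j) %% n.+1%:Z)%Z by rewrite modz_ge0.
have E : (per_idx i j : nat)%:R = (i%:R + j%:~R - q%:~R * n.+1%:R :> R).
  rewrite /per_idx inordK; last first.
    by rewrite -ltz_nat gez0_abs // ltz_pmod.
  have -> (a : int) : 0 <= a -> (`|a|%N)%:R = a%:~R :> R.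
    by move=> a0; rewrite -[in RHS](gez0_abs a0).
  - by rewrite /modz -/q rmorphB rmorphD rmorphM.
  exact: lt0.
rewrite -[RHS](cis_per _ (- (q * k))) /mesh_point E; congr cis.
have -> : (- (q * k))%:~R * (pi *+ 2) = - (q%:~R * (w * n.+1%:R)) :> R.
  by rewrite wk mulrNz intrM mulNr mulrA.
by field.
Qed.

Lemma fd_mx_mode (R : realType) (p n : nat) (w : R) (k : int) :
  w * n.+1%:R = k%:~R * (pi *+ 2) ->
  map_mx (real_complex R) (fd_mx R p n) *m fourier_mode n w =
  fd_symbol p w *: fourier_mode n w.
Proof.
move=> wk; apply/matrixP => i j0; rewrite (ord1 j0) !mxE.
have h0 : mesh_width R n != 0 by rewrite mulf_neq0 ?invr_neq0 ?pnatr_eq0.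
rewrite /fd_symbol fd_derivE mulr_suml.
transitivity (\sum_(j < n.+1) \sum_(s < p.+1)
    (per_idx i (s%:Z - (ell p)%:Z) == j)%:R *
    (tnth (p.+1.-lagrange (fd_node p 0 1)) s : {poly R[i]})^`().[0] *
    fourier_mode n w j 0).
  apply: eq_bigr => j _; rewrite !mxE fd_derivE mulr_sumr rmorph_sum mulr_suml.
  apply: eq_bigr => s _; rewrite mulrCA rmorphM lagr_scale //= lagr_map.
  by rewrite rmorph_nat.
rewrite exchange_big /=; apply: eq_bigr => s _.
rewrite (bigD1 (per_idx i (s%:Z - (ell p)%:Z))) //= eqxx mul1r big1 ?addr0.
  by rewrite (mode_shift i _ wk) mxE mulrA [X in X * _]mulrC.
by move=> j /negPf; rewrite eq_sym => ->; rewrite !mul0r.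
Qed.

Lemma horner_mx_mode (K : fieldType) (n : nat) (A : 'M[K]_n.+1) (z : K)
    (v : 'cV[K]_n.+1) (P : {poly K}) :
  A *m v = z *: v -> horner_mx A P *m v = P.[z] *: v.
Proof.
move=> Av; elim/poly_ind: P => [|P c IH].
  by rewrite rmorph0 mul0mx horner0 scale0r.
rewrite rmorphD rmorphM /= horner_mx_X horner_mx_C mulmxDl -mulmxA Av.
by rewrite -scalemxAr IH mul_scalar_mx !hornerE scalerDl scalerA mulrC.
Qed.

(* The periodic mesh carries the frequencies w in (2 pi / n_x) Z. At these,
   the symbol is the eigenvalue of the time-stepping matrix. *)
Lemma mol_mx_mode (R : realType) (p n : nat) (M : rk_method R)
    (alpha dt w : R) (k : int) :
  w * n.+1%:R = k%:~R * (pi *+ 2) ->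
  horner_mx (mol_arg p n alpha dt) (rk_den M) \in unitmx ->
  map_mx (real_complex R) (mol_mx p n M alpha dt) *m fourier_mode n w =
  mol_symbol p M alpha dt (mesh_width R n) w *: fourier_mode n w.
Proof.
move=> wk; set Z := mol_arg _ _ _ _ => uQ.
set v := fourier_mode n w; set z := real_complex R (- (alpha * dt / mesh_width R n)) * fd_symbol p w.
have Zv : map_mx (real_complex R) Z *m v = z *: v.
  by rewrite map_mxZ -scalemxAl (fd_mx_mode _ wk) scalerA.
rewrite map_mxM map_invmx !map_horner_mx /= /mol_symbol -/z /rk_stab.
set P := map_poly _ (rk_num M); set Q := map_poly _ (rk_den M).
have uQ' : horner_mx (map_mx (real_complex R) Z) Q \in unitmx.
  by rewrite -map_horner_mx map_unitmx.
have v0 : v != 0.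
  apply/eqP => /matrixP /(_ 0 0); rewrite !mxE => /eqP.
  rewrite eq_complex /= => /andP[/eqP c0 /eqP s0].
  by have := cos2Dsin2 (w * mesh_point R n 0%N / mesh_width R n);
    rewrite c0 s0 expr0n addr0 => /eqP; rewrite eq_sym oner_eq0.
have Qv := horner_mx_mode Q Zv.
have Qz : Q.[z] != 0.
  apply: contra v0 => /eqP Q0; move: Qv; rewrite Q0 scale0r => Qv0.
  by rewrite -[v](mulKmx uQ') Qv0 mulmx0.
have iQv : invmx (horner_mx (map_mx (real_complex R) Z) Q) *m v = Q.[z]^-1 *: v.
  apply: (can_inj (mulKmx uQ')); rewrite mulKVmx // -scalemxAr Qv scalerA.
  by rewrite mulVf // scale1r.
by rewrite -mulmxA iQv -scalemxAr (horner_mx_mode P Zv) scalerA mulrC.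
Qed.

(* Main.v *)
(* With c = alpha dt / h and z = - c L_p(w), where L_p(w) = i w - e_FD (i w)^(p+1) + O(w^(p+2)),
   an order-p stability function is R(z) = e^z + e_RK z^(p+1) + O(z^(p+2)). Hence
     lambda^m - mu = m (e_RK^fine - m^p e_RK^coarse) z^(p+1) + O(z^(p+2)),
   while on the characteristic theta = - w c the leading terms of 1 - e^(-i m theta) mu cancel
   up to - m c (e_FD + (m c)^p e_RK^coarse) (i w)^(p+1), p + 1 being even. In the quotient
   w cancels. The relative errors of the denominator involve c^p (h + dt); they are still
   O(h + dt), because a denominator factor bounded below by delta is also bounded below by
   a multiple of c^p. Only the real exponential cis is needed: mu is compared with cis (- m c w)
   through the truncated exponential series. *)
Require Import Defs.
From HB Require Import structures.
From mathcomp Require Import all_boot all_order all_algebra.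
From mathcomp Require Import all_classical all_reals all_analysis.
From mathcomp Require Import complex ring lra.
Import Order.TTheory GRing.Theory Num.Theory.
Import numFieldNormedType.Exports.
Local Open Scope classical_set_scope.
Local Open Scope ring_scope.

Set Implicit Arguments.
Unset Strict Implicit.
Unset Printing Implicit Defensive.

Local Notation normc := Normc.normc.

(** * Elementary estimates for the real-valued complex modulus *)

Lemma Re_norm (R : realType) (z : R[i]) : complex.Re `|z| = normc z.
Proof. by case: z. Qed.

Lemma normc_ge0 (R : realType) (z : R[i]) : 0 <= normc z.
Proof. by case: z => a b; exact: sqrtr_ge0. Qed.

Lemma normcD (R : realType) (z t : R[i]) : normc (z + t) <= normc z + normc t.
Proof. exact: le_normcD. Qed.

Lemma normcN (R : realType) (z : R[i]) : normc (- z) = normc z.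
Proof. exact: normcN. Qed.

Lemma normcB (R : realType) (z t : R[i]) : normc (z - t) <= normc z + normc t.
Proof. by rewrite -(normcN t); exact: normcD. Qed.

Lemma normc_dist (R : realType) (z t : R[i]) :
  `|normc z - normc t| <= normc (z - t).
Proof.
have := normcD (z - t) t; have := normcD (t - z) z.
by rewrite !subrK -(opprB z t) normcN ler_norml; lra.
Qed.

Lemma normcX (R : realType) (z : R[i]) n : normc (z ^+ n) = normc z ^+ n.
Proof.
by elim: n => [|n IH]; rewrite ?expr0 ?Normc.normc1 // !exprS Normc.normcM IH.
Qed.

Lemma normc_real (R : realType) (x : R) : normc (real_complex R x) = `|x|.
Proof. by rewrite /= expr0n addr0 sqrtr_sqr. Qed.

Lemma normc_le_abs (R : realType) (z : R[i]) :
  normc z <= `|complex.Re z| + `|complex.Im z|.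
Proof.
case: z => a b /=; rewrite -[leRHS]ger0_norm ?addr_ge0 // -sqrtr_sqr.
rewrite ler_sqrt ?sqr_ge0 // sqrrD !real_normK ?num_real //.
by rewrite -addrA lerD2l lerDr mulrn_wge0 // mulr_ge0.
Qed.

Lemma normc_cis (R : realType) (t : R) : normc (cis t) = 1.
Proof. by rewrite /cis /= cos2Dsin2 sqrtr1. Qed.

Lemma normc_sum (R : realType) (I : Type) (r : seq I) (F : I -> R[i]) :
  normc (\sum_(i <- r) F i) <= \sum_(i <- r) normc (F i).
Proof.
elim: r => [|i r IH]; first by rewrite !big_nil Normc.normc0.
by rewrite !big_cons (le_trans (normcD _ _)) // lerD2l.
Qed.

(** * Size of complex polynomials on the unit disc and near the origin *)

Lemma horner_bounded (R : realType) (P : {poly R[i]}) :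
  exists2 K : R, 0 < K & forall z, normc z <= 1 -> normc P.[z] <= K.
Proof.
elim/poly_ind: P => [|P c [K K0 IH]].
  by exists 1 => // z _; rewrite horner0 Normc.normc0.
exists (K + normc c) => [|z z1]; first by rewrite ltr_wpDr ?normc_ge0.
rewrite !hornerE (le_trans (normcD _ _)) // lerD2r Normc.normcM.
by rewrite -[K]mulr1 ler_pM ?normc_ge0 ?IH.
Qed.

Lemma poly_dvdXn (K : nzRingType) (P : {poly K}) N :
  (forall i, (i < N)%N -> P`_i = 0) -> exists Q, P = Q * 'X^N.
Proof.
move=> P0; exists (drop_poly N P); rewrite -[LHS](poly_take_drop N).
suff -> : take_poly N P = 0 by rewrite add0r.
by apply/polyP => i; rewrite coef_take_poly coef0; case: ifP => // /P0.
Qed.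

Lemma horner_high_order (R : realType) (P : {poly R[i]}) N :
  (forall i, (i < N)%N -> P`_i = 0) ->
  exists2 K : R, 0 < K &
    forall z, normc z <= 1 -> normc P.[z] <= K * normc z ^+ N.
Proof.
move=> /poly_dvdXn[Q ->]; have [K K0 QK] := horner_bounded Q.
exists K => // z z1; rewrite hornerM hornerXn Normc.normcM normcX.
by rewrite ler_wpM2r ?exprn_ge0 ?normc_ge0 ?QK.
Qed.

(** * Taylor coefficients of rational functions *)

(** Division in increasing powers of ['X]: since [Q.[0]] is invertible, a multiple of [Q] cancels
    the constant term of the current remainder [S], and a further factor ['X] comes out. *)
Lemma poly_series_div (K : fieldType) (P Q : {poly K}) N : Q.[0] != 0 ->
  exists T S : {poly K}, (size T <= N)%N /\ P = Q * T + S * 'X^N.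
Proof.
move=> Q0; elim: N => [|N [T [S [sT ->]]]].
  by exists 0, P; rewrite size_poly0 mulr0 add0r mulr1.
pose a := S.[0] / Q.[0].
have : root (S - a *: Q) 0.
  by rewrite rootE hornerD hornerN hornerZ /a divfK // subrr.
move=> /factor_theorem[S']; rewrite subr0 => E.
exists (T + a *: 'X^N), S'; split.
  rewrite (leq_trans (size_polyD _ _)) // geq_max (leq_trans sT) //=.
  by rewrite (leq_trans (size_scale_leq _ _)) // size_polyXn.
have -> : S = S' * 'X + a *: Q by rewrite -E subrK.
by rewrite exprS mulrDr mulrDl -!scalerAr -!scalerAl -!mulrA -addrA
  [_ + S' * _]addrC.
Qed.

(** Differentiation preserves the form [T + S x^N / Q], with [Q ^+ 2] for [Q] and one power of [x]
    lost, so induction on [j] with [f] generalized applies. The formula is asked only near 0 because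
    [Q] may vanish elsewhere. *)
Lemma derive1n_quotient (R : realType) (f : R -> R) (T S Q : {poly R}) (N j : nat) :
  Q.[0] != 0 -> (j < N)%N ->
  (\forall x \near 0, f x = T.[x] + S.[x] * x ^+ N / Q.[x]) ->
  derive1n j f 0 = j`!%:R * T`_j.
Proof.
elim: j f T S Q N => [|j IH] f T S Q [|N] // Q0 jN fE.
  rewrite derive1n0 (nbhs_singleton fE) expr0n mulr0 mul0r addr0 mul1r.
  by rewrite horner_coef0.
have nQ : \forall x \near (0 : R), Q.[x] != 0.
  apply: (@continuous_horner R Q 0 [set y | y != 0]).
  by apply: open_nbhs_nbhs; split; [exact: open_neq | exact: Q0].
(* Quotient rule: the derivative of [S x^(N+1) / Q] is [(S' x Q + (N+1) S Q - S x Q') x^N / Q^2]. *)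
rewrite derive1Sn (IH _ T^`() (S^`() * 'X * Q + S * Q *+ N.+1 - S * 'X * Q^`())
  (Q ^+ 2) N) ?horner_exp ?expf_neq0 //.
  by rewrite coef_deriv factS natrM -[_ *+ j.+1]mulr_natl mulrA [j`!%:R * _]mulrC.
(* Differentiating at a nearby [x] requires the formula on a whole neighbourhood of [x]. *)
have /nbhs_interior fE' := fE.
near=> x.
have Qx : Q.[x] != 0 by near: x.
rewrite derive1E (@near_eq_derive _ _ _ _
  (horner T + (horner S * (id ^+ N.+1) * (fun x => Q.[x]^-1))) x 1); last first.
  near: x; apply: filterS fE' => y; apply: filterS => z ->.
  by rewrite !fctE.
have dQ : is_derive x (1 : R) (fun x => Q.[x]^-1) (- Q.[x] ^- 2 *: Q^`().[x]).
  apply: DeriveDef; first exact: derivableV.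
  by rewrite deriveV // derive_val.
have -> : (S^`() * 'X * Q + S * Q *+ N.+1 - S * 'X * Q^`()).[x] =
    S^`().[x] * x * Q.[x] + N.+1%:R * (S.[x] * Q.[x]) - S.[x] * x * Q^`().[x].
  by rewrite !(hornerD, hornerN, hornerM, hornerMn, hornerX) mulr_natl.
by rewrite derive_val !fctE /GRing.scale /= horner_exp exprS; field.
Unshelve. all: by end_near. Qed.

Lemma det_horner (K : comNzRingType) n (A : 'M[{poly K}]_n) (x : K) :
  (\det A).[x] = \det (map_mx (horner^~ x) A).
Proof.
by rewrite -[LHS]/(horner_eval x _) -det_map_mx.
Qed.

Lemma rk_den0 (R : realType) (M : rk_method R) : (rk_den M).[0] = 1.
Proof.
rewrite /rk_den det_horner (_ : map_mx _ _ = 1%:M) ?det1 //.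
by apply/matrixP => i j; rewrite !mxE !hornerE subr0; case: eqP; rewrite hornerE.
Qed.

(** Turns the coefficients [rk_taylor], defined by real derivatives, into an exact polynomial
    identity, which can then be carried over to complex arguments. *)
Lemma rk_taylor_expansion (R : realType) (M : rk_method R) N :
  exists S : {poly R},
    rk_num M = rk_den M * \poly_(j < N) rk_taylor M j + S * 'X^N.
Proof.
have Q0 : (rk_den M).[0] != 0 by rewrite rk_den0 oner_neq0.
have [T [S [sT E]]] := poly_series_div (rk_num M) N Q0.
exists S; rewrite E; congr (_ * _ + _).
apply/polyP => j; rewrite coef_poly; case: ltnP => jN; last first.
  by rewrite nth_default // (leq_trans sT).
rewrite /rk_taylor (derive1n_quotient (T := T) (S := S) Q0 jN).
  by rewrite mulrC mulKf // pnatr_eq0 -lt0n fact_gt0.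
have nQ : \forall x \near (0 : R), (rk_den M).[x] != 0.
  apply: (@continuous_horner R (rk_den M) 0 [set y | y != 0]).
  by apply: open_nbhs_nbhs; split; [exact: open_neq | exact: Q0].
near=> x.
have Qx : (rk_den M).[x] != 0 by near: x.
by rewrite E !hornerE; field.
Unshelve. all: by end_near. Qed.

(** * Taylor remainders of cosine, sine and [cis] *)

(** The mean value theorem on the segment between 0 and [t], for either sign of [t], gains one power
    of [|t|]. *)
Lemma derive_pow_bound (R : realType) (f df : R -> R) N :
  (forall t : R, is_derive t (1 : R) f (df t)) -> f 0 = 0 ->
  (forall t, `|df t| <= `|t| ^+ N) -> forall t, `|f t| <= `|t| ^+ N.+1.
Proof.
move=> fdf f0 dfN t.
have cf (A : set R) : {within A, continuous f}.
  apply: continuous_subspaceT => x; apply: differentiable_continuous.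
  by apply/derivable1_diffP; have [] := fdf x.
suff [c [ct ft]] : exists c, `|c| <= `|t| /\ `|f t| = `|df c| * `|t|.
  rewrite ft exprSr ler_wpM2r // (le_trans (dfN c)) //.
  by rewrite lerXn2r ?nnegrE.
have [t0|t0] := leP 0 t.
  have [c /itvP ct E] := MVT_segment t0 (fun x _ => fdf x) (cf _).
  exists c; rewrite (ger0_norm t0) ger0_norm ?ct //; split => //.
  by move: E; rewrite f0 !subr0 => ->; rewrite normrM (ger0_norm t0).
have [c /itvP ct E] := MVT_segment (ltW t0) (fun x _ => fdf x) (cf _).
exists c; rewrite (ltr0_norm t0) ler0_norm ?ct // lerN2 ct; split => //.
by move: E; rewrite f0 !sub0r -normrN => ->; rewrite normrM normrN (ltr0_norm t0).
Qed.

Lemma exp_i_rec (R : realType) j :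
  complex.Re ((Complex 0 1 : R[i]) ^+ j.+1) = - complex.Im ((Complex 0 1 : R[i]) ^+ j) /\
  complex.Im ((Complex 0 1 : R[i]) ^+ j.+1) = complex.Re ((Complex 0 1 : R[i]) ^+ j).
Proof. by rewrite exprS; case: (_ ^+ j) => a b /=; split; ring. Qed.

(** Both remainders are bounded in one induction, since the derivative of each is, up to sign, the
    other at the preceding order. Writing the coefficients as real and imaginary parts of powers of
    [i] makes this recursion uniform in the parity of [j]. *)
Lemma cos_sin_taylor (R : realType) N (y : R) :
  `|cos y - (\poly_(j < N) (complex.Re ((Complex 0 1 : R[i]) ^+ j) / j`!%:R)).[y]|
    <= `|y| ^+ N /\
  `|sin y - (\poly_(j < N) (complex.Im ((Complex 0 1 : R[i]) ^+ j) / j`!%:R)).[y]|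
    <= `|y| ^+ N.
Proof.
pose P (F : R[i] -> R) N := \poly_(j < N) (F ((Complex 0 1 : R[i]) ^+ j) / j`!%:R).
have dP (F G : R[i] -> R) n : (forall j, F ((Complex 0 1) ^+ j.+1) = G ((Complex 0 1) ^+ j)) ->
    (P F n.+1)^`() = P G n.
  move=> FG; apply/polyP => j; rewrite coef_deriv !coef_poly ltnS.
  case: ltnP => _; last by rewrite mul0rn.
  have j0 : (j`!%:R : R) != 0 by rewrite pnatr_eq0 -lt0n fact_gt0.
  by rewrite FG factS natrM -mulr_natr; field; rewrite j0 nat1r pnatr_eq0.
rewrite -/(P _ N) -/(P _ N); elim: N y => [|N IH] y.
  by rewrite /P !poly_def !big_ord0 !horner0 !subr0 expr0 cos_max sin_max.
have P0 (F : R[i] -> R) : (P F N.+1).[0] = F 1.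
  by rewrite horner_coef0 coef_poly /= expr0 divr1.
split.
- apply: (derive_pow_bound (f := fun y => cos y - (P (@complex.Re R) N.+1).[y])
    (df := fun y => - (sin y - (P (@complex.Im R) N).[y]))) => [t||t].
  + apply: is_derive_eq.
    rewrite (dP _ (fun z => - complex.Im z)); last by move=> j; case: (exp_i_rec R j).
    rewrite opprB addrC; congr (_ + _); rewrite -hornerN; congr (_.[_]).
    by apply/polyP => j; rewrite coefN !coef_poly; case: ifP; rewrite ?oppr0 ?mulNr ?opprK.
  + by rewrite cos0 P0 subrr.
  + by rewrite normrN; case: (IH t).
- apply: (derive_pow_bound (f := fun y => sin y - (P (@complex.Im R) N.+1).[y])
    (df := fun y => cos y - (P (@complex.Re R) N).[y])) => [t||t].
  + apply: is_derive_eq.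
    by rewrite (dP _ (@complex.Re R)) // => j; case: (exp_i_rec R j).
  + by rewrite sin0 P0 subrr.
  + by case: (IH t).
Qed.

Definition trunc_exp (K : fieldType) N : {poly K} := \poly_(j < N) (j`!%:R)^-1.

(** The factor 2 comes from bounding the modulus by the sum of the real and imaginary remainders. *)
Lemma cis_taylor (R : realType) N (y : R) :
  normc (cis y - (trunc_exp R[i] N).[Complex 0 y]) <= 2 * `|y| ^+ N.
Proof.
have [Hc Hs] := cos_sin_taylor N y.
have E : (trunc_exp R[i] N).[Complex 0 y] = Complex
    (\poly_(j < N) (complex.Re ((Complex 0 1 : R[i]) ^+ j) / j`!%:R)).[y]
    (\poly_(j < N) (complex.Im ((Complex 0 1 : R[i]) ^+ j) / j`!%:R)).[y].
  rewrite !horner_poly.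
  transitivity (\sum_(j < N) real_complex R (y ^+ j / j`!%:R) * (Complex 0 1) ^+ j).
    apply: eq_bigr => j _.
    have -> : Complex 0 y = real_complex R y * Complex 0 1.
      by rewrite /real_complex_def; apply/eqP; rewrite eq_complex /=; apply/andP; split; apply/eqP; ring.
    by rewrite exprMn mulrA rmorphM rmorphXn fmorphV rmorph_nat; congr (_ * _); rewrite mulrC.
  elim/big_rec3: _ => [|j b a z _ ->]; first by [].
  case: (Complex 0 1 ^+ j) => u v; apply/eqP; rewrite eq_complex /=.
  by apply/andP; split; apply/eqP; ring.
rewrite (le_trans (normc_le_abs _)) // E /= mulr2n mulrDl !mul1r lerD //.
Qed.

(** * Stability functions as perturbations of the exponential *)

(** The remainder is exactly [S z^N / Q], where [Q] is the denominator. As [Q] is 1 at the origin,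
    its modulus stays above 1/2 on a small disc. *)
Lemma rk_stab_taylor (R : realType) (M : rk_method R) N :
  exists K r : R, [/\ 0 < K, 0 < r, r <= 1 & forall z, normc z <= r ->
    normc (rk_stab M z -
      (map_poly (real_complex R) (\poly_(j < N) rk_taylor M j)).[z])
    <= K * normc z ^+ N].
Proof.
have [S E] := rk_taylor_expansion M N.
set T := \poly_(j < N) _.
set Q := map_poly (real_complex R) (rk_den M).
have Q10 i : (i < 1)%N -> (Q - 1)`_i = 0.
  case: i => // _; rewrite coefB coef_map -horner_coef0 rk_den0 coef1 /=.
  by rewrite rmorph1 subrr.
have [KQ KQ0 QK] := horner_high_order Q10.
have [KS KS0 SK] := horner_bounded (map_poly (real_complex R) S).
(* With this radius [KQ |z| <= 1/2], hence [|Q(z)| >= 1/2], and also [|z| <= 1], as the polynomial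
   bounds require. The factor 2 bounds [1 / |Q(z)|]. *)
exists (2 * KS), (2 * KQ + 1)^-1; split.
- by rewrite mulr_gt0.
- by rewrite invr_gt0; lra.
- by rewrite invf_le1; lra.
move=> z zr.
have z1 : normc z <= 1 by apply: le_trans zr _; rewrite invf_le1; lra.
have Qz : 2^-1 <= normc Q.[z].
  have := QK z z1; rewrite expr1 => QKz.
  have zK : KQ * normc z <= 2^-1.
    have : (2 * KQ + 1) * normc z <= 1.
      by rewrite -ler_pdivlMl ?mulr1 //; lra.
    by have := normc_ge0 z; lra.
  have := normcB Q.[z] (Q.[z] - 1).
  rewrite opprB addrC subrK Normc.normc1 => QB.
  move: QKz; rewrite hornerD hornerN hornerC => QKz; lra.
have Q0 : Q.[z] != 0.
  by apply: contraTneq Qz => ->; rewrite Normc.normc0 -ltNge invr_gt0.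
rewrite /rk_stab E -/T rmorphD !rmorphM /= map_polyXn -/Q !hornerE /=.
have -> : forall a b : R[i], (Q.[z] * a + b) / Q.[z] - a = b / Q.[z].
  by move=> a b; field.
rewrite !Normc.normcM Normc.normcV normcX mulrAC.
rewrite ler_wpM2r ?exprn_ge0 ?normc_ge0 //.
rewrite mulrC ler_pM ?normc_ge0 ?invr_ge0 ?normc_ge0 ?SK //.
by rewrite -[leRHS]invrK lef_pV2 // posrE ?invr_gt0 // (lt_le_trans _ Qz) ?invr_gt0.
Qed.

(* Membership in the class of series [exp (a X) + c X^N + O(X^(N+1))]. *)
Definition exp_mod (R : fieldType) N (a c : R) (P : {poly R}) :=
  forall j, (j <= N)%N -> P`_j = a ^+ j / j`!%:R + (if j == N then c else 0).

(** The exponential parts combine by the binomial theorem. Up to degree [N], a perturbation of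
    degree [N > 0] can only meet the constant term 1 of the other factor, so the two perturbations
    add. *)
Lemma exp_mod_mul (R : numFieldType) N (a b c d : R) (P Q : {poly R}) :
  (0 < N)%N -> exp_mod N a c P -> exp_mod N b d Q ->
  exp_mod N (a + b) (c + d) (P * Q).
Proof.
move=> N0 HP HQ k kN; rewrite coefM.
have f0 n : (n`!%:R : R) != 0 by rewrite pnatr_eq0 -lt0n fact_gt0.
transitivity (\sum_(j < k.+1) (b ^+ (k - j) * a ^+ j *+ 'C(k, j) / k`!%:R
   + (if (j : nat) == N then c else 0) + (if (k - j)%N == N then d else 0))).
  apply: eq_bigr => -[j jk] _ /=; rewrite ltnS in jk.
  rewrite HP ?(leq_trans jk) // HQ ?(leq_trans (leq_subr _ _)) //.
  have -> : b ^+ (k - j) * a ^+ j *+ 'C(k, j) / k`!%:R =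
      a ^+ j / j`!%:R * (b ^+ (k - j) / (k - j)`!%:R).
    rewrite -(bin_fact jk) !natrM -mulr_natr; field.
    by rewrite !f0 pnatr_eq0 -lt0n bin_gt0.
  have [jN|jN] := eqVneq j N.
    have -> : (k - j)%N = 0%N by apply/eqP; rewrite subn_eq0 jN.
    by rewrite eq_sym (gtn_eqF N0) !expr0 fact0 divr1 !addr0 !mulr1.
  rewrite !addr0; have [kjN|_] := eqVneq (k - j)%N N; last by rewrite !addr0.
  have -> : j = 0%N.
    apply/eqP; rewrite -leqn0 -(leq_add2r N) add0n (leq_trans _ kN) //.
    by rewrite -kjN addnC subnK.
  by rewrite expr0 fact0 divr1 !mul1r.
rewrite !big_split /= -addrA; congr (_ + _).
  by rewrite [a + b]addrC exprDn mulr_suml.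
have -> : \sum_(j < k.+1) (if (j : nat) == N then c else 0) = if k == N then c else 0.
  rewrite big_ord_recr /= big1 ?add0r // => j _.
  by rewrite ltn_eqF // (leq_trans (ltn_ord j)).
have -> : \sum_(j < k.+1) (if (k - j)%N == N then d else 0) = if k == N then d else 0.
  rewrite big_ord_recl /= subn0 big1 ?addr0 // => j _.
  rewrite ltn_eqF // (leq_trans _ kN) // /bump /= add1n ltn_subrL /=.
  exact: leq_ltn_trans (ltn_ord j).
by case: eqP => // _; rewrite addr0.
Qed.

Lemma exp_mod_pow (R : numFieldType) N (c : R) (P : {poly R}) m :
  (0 < N)%N -> exp_mod N 1 c P -> exp_mod N m%:R (m%:R * c) (P ^+ m).
Proof.
move=> N0 HP; elim: m => [|m IH].
  move=> k kN; rewrite expr0 coef1 mul0r expr0n if_same addr0.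
  by case: k {kN} => [|k]; rewrite ?fact0 ?divr1 ?mul0r.
by rewrite exprS -nat1r mulrDl mul1r; exact: exp_mod_mul.
Qed.

Lemma taylor_exp_mod (R : realType) (M : rk_method R) p : rk_order M p ->
  exp_mod p.+1 1 (err_RK M p) (\poly_(j < p.+2) rk_taylor M j).
Proof.
move=> [Hp _] j jp; rewrite coef_poly ltnS jp expr1n div1r.
have [->|jp'] := eqVneq j p.+1; first by rewrite /err_RK addrC subrK.
by rewrite addr0 Hp // -ltnS ltn_neqAle jp'.
Qed.

(** The cofactor of [a - b] is a sum of [m] monomials of degree [m - 1]. *)
Lemma normc_subX (R : realType) (a b : R[i]) (B : R) m :
  normc a <= B -> normc b <= B ->
  normc (a ^+ m - b ^+ m) <= m%:R * B ^+ m.-1 * normc (a - b).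
Proof.
case: m => [|m] aB bB; first by rewrite !expr0 subrr Normc.normc0 !mul0r.
rewrite subrXX Normc.normcM mulrC ler_wpM2r ?normc_ge0 //.
rewrite (le_trans (normc_sum _ _)) //= mulr_natl -[in leRHS](card_ord m.+1).
rewrite -sumr_const ler_sum // => i _; rewrite Normc.normcM !normcX.
have -> : B ^+ m = B ^+ (m.+1 - i.+1) * B ^+ i.
  by rewrite -exprD subSS subnK // -ltnS.
have B0 : 0 <= B by apply: le_trans aB; exact: normc_ge0.
by rewrite ler_pM ?exprn_ge0 ?normc_ge0 // lerXn2r ?nnegrE ?normc_ge0.
Qed.

Lemma horner_lipschitz (R : realType) (P : {poly R[i]}) :
  exists2 K : R, 0 < K & forall a b, normc a <= 1 -> normc b <= 1 ->
    normc (P.[b] - P.[a]) <= K * normc (b - a).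
Proof.
elim/poly_ind: P => [|P c [K K0 IH]].
  exists 1 => // a b _ _.
  by rewrite !horner0 subrr Normc.normc0 mul1r normc_ge0.
have [B B0 PB] := horner_bounded P.
exists (K + B) => [|a b a1 b1]; first exact: addr_gt0.
rewrite !hornerE.
have -> : P.[b] * b + c - (P.[a] * a + c) = (P.[b] - P.[a]) * b + P.[a] * (b - a).
  by ring.
rewrite (le_trans (normcD _ _)) // !Normc.normcM mulrDl lerD //.
  by rewrite -[leRHS]mulr1 ler_pM ?normc_ge0 ?IH.
by rewrite ler_wpM2r ?normc_ge0 ?PB.
Qed.

Lemma horner_linearize (R : realType) (P : {poly R[i]}) : P`_1 = 1 ->
  exists2 K : R, 0 < K & forall a d, normc a + normc d <= 1 ->
    normc (P.[a + d] - P.[a] - d) <= K * (normc d * (normc a + normc d)).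
Proof.
move=> P1; have [Q PQ] : exists Q, P - (P`_0)%:P - 'X = Q * 'X^2.
  apply: poly_dvdXn => -[|[|//]] _; rewrite !coefB coefC coefX ?subr0 ?subrr //.
  by rewrite P1 subrr.
have PE x : P.[x] = P`_0 + x + Q.[x] * x * x.
  have {1}-> : P = Q * 'X^2 + 'X + (P`_0)%:P by rewrite -PQ; ring.
  by rewrite !hornerD hornerM hornerXn hornerX hornerC; ring.
have [K K0 QK] := horner_lipschitz (Q * 'X).
have [B B0 QB] := horner_bounded Q.
exists (K + B) => [|a d ad1]; first exact: addr_gt0.
have [a0 d0] := (normc_ge0 a, normc_ge0 d).
have a1 : normc a <= 1 by lra.
have := QK a (a + d) a1 (le_trans (normcD _ _) ad1).
rewrite !hornerM !hornerX addrAC subrr add0r => QKad.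
have -> : P.[a + d] - P.[a] - d =
    (Q.[a + d] * (a + d) - Q.[a] * a) * (a + d) + Q.[a] * a * d.
  by rewrite !PE; ring.
rewrite (le_trans (normcD _ _)) // !Normc.normcM mulrDl lerD //.
  by rewrite mulrA ler_pM ?normc_ge0 ?normcD.
rewrite -mulrA ler_pM ?normc_ge0 ?mulr_ge0 ?QB // mulrC ler_wpM2l //.
by rewrite lerDl.
Qed.

(** Up to degree [p + 1], the [m]-th power of the fine series and the coarse series at [m z] are
    both perturbations of [exp (m z)]. The coefficients of degree [p + 1] of these perturbations are
    [m e_fine] and [m^(p+1) e_coarse], which yields the leading term. *)
Lemma rk_stab_power_diff (R : realType) (fine coarse : rk_method R) p m :
  rk_order fine p -> rk_order coarse p -> (0 < m)%N ->
  exists K r : R, [/\ 0 < K, 0 < r, r <= 1 & forall z, normc z <= r ->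
    normc (rk_stab fine z ^+ m - rk_stab coarse (m%:R * z) -
      real_complex R (m%:R * (err_RK fine p - m%:R ^+ p * err_RK coarse p))
        * z ^+ p.+1) <= K * normc z ^+ p.+2].
Proof.
move=> Hf Hc m0; set e := m%:R * _.
have mR : 0 < m%:R :> R by rewrite ltr0n.
have [K1 [r1 [K10 r10 r11 H1]]] := rk_stab_taylor fine p.+2.
have [K2 [r2 [K20 r20 _ H2]]] := rk_stab_taylor coarse p.+2.
move: H1 H2; set F := \poly_(j < _) _; set G := \poly_(j < _) _ => H1 H2.
(* [G'] is [G] with [m 'X] substituted for ['X]. *)
pose G' : {poly R} := \poly_(j < p.+2) (G`_j * m%:R ^+ j).
have D0 j : (j < p.+2)%N -> (map_poly (real_complex R) (F ^+ m - G' - e *: 'X^(p.+1)))`_j = 0.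
  move=> jp; rewrite coef_map -[RHS](rmorph0 (real_complex R)); congr (real_complex R _).
  rewrite !coefB coefZ coefXn (exp_mod_pow m (ltn0Sn p) (taylor_exp_mod Hf)) // coef_poly jp.
  rewrite (taylor_exp_mod Hc) // expr1n; case: eqVneq => [->|_].
    by rewrite /e exprS mulr1; ring.
  by rewrite mulr0 subr0 !addr0 mulrC div1r subrr.
have [K3 K30 H3] := horner_high_order D0.
have [B B0 HB] := horner_bounded (map_poly (real_complex R) F).
(* The three summands pay for replacing the fine stability function by [F] inside the power, for
   replacing the coarse one by [G], and for the terms of degree at least [p + 2]. The radius keeps
   both [z] and [m z] in range. *)
exists (m%:R * (K1 + B) ^+ m.-1 * K1 + K2 * m%:R ^+ p.+2 + K3), (Num.min r1 (r2 / m%:R)).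
have KB0 : 0 < K1 + B by exact: addr_gt0.
split.
- by rewrite (addr_gt0 (addr_gt0 _ _)) // mulr_gt0 ?exprn_gt0 // mulr_gt0 ?exprn_gt0.
- by rewrite lt_min r10 divr_gt0.
- by rewrite ge_min r11.
move=> z; rewrite le_min => /andP[zr1 zr2].
have z1 := le_trans zr1 r11.
have nm : normc (m%:R * z) = m%:R * normc z.
  by rewrite Normc.normcM -(rmorph_nat (real_complex R)) normc_real normr_nat.
have G'E : (map_poly (real_complex R) G').[z] = (map_poly (real_complex R) G).[m%:R * z].
  rewrite !(@horner_coef_wide _ p.+2) ?size_map_poly ?size_poly //.
  apply: eq_bigr => j _; rewrite !coef_map /= [G'`_j]coef_poly ltn_ord rmorphM rmorphXn.
  by rewrite rmorph_nat exprMn mulrA.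
have -> : rk_stab fine z ^+ m - rk_stab coarse (m%:R * z) - real_complex R e * z ^+ p.+1 =
    (rk_stab fine z ^+ m - (map_poly (real_complex R) F).[z] ^+ m)
    - (rk_stab coarse (m%:R * z) - (map_poly (real_complex R) G).[m%:R * z])
    + (map_poly (real_complex R) (F ^+ m - G' - e *: 'X^(p.+1))).[z].
  rewrite -G'E !rmorphB rmorphXn /= map_polyZ map_polyXn !hornerD !hornerN.
  by rewrite hornerZ hornerXn horner_exp; ring.
rewrite (le_trans (normcD _ _)) // mulrDl lerD ?H3 //.
rewrite (le_trans (normcB _ _)) // mulrDl lerD //; last first.
  rewrite (le_trans (H2 _ _)) //; last by rewrite nm exprMn mulrA.
  by rewrite nm -ler_pdivlMl // mulrC.
have H1z := H1 z zr1.
have Fz := HB z z1.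
rewrite (le_trans (@normc_subX _ _ _ (K1 + B) _ _ _)) //.
- rewrite -[rk_stab _ _](subrK (map_poly (real_complex R) F).[z]).
  rewrite (le_trans (normcD _ _)) // lerD // (le_trans H1z) //.
  by rewrite ler_piMr ?(ltW K10) // exprn_ile1 ?normc_ge0.
- by rewrite (le_trans Fz) // lerDr ltW.
by rewrite -[leRHS]mulrA ler_wpM2l ?mulr_ge0 ?exprn_ge0 ?(ltW KB0).
Qed.

Lemma rk_stab_near1 (R : realType) (M : rk_method R) p : rk_order M p ->
  exists K r : R, [/\ 0 < K, 0 < r, r <= 1 & forall z, normc z <= r ->
    `|normc (rk_stab M z) - 1| <= K * normc z].
Proof.
move=> HM.
have [K1 [r [K10 r0 r1 H1]]] := rk_stab_taylor M 1.
exists K1, r; split => // z zr; rewrite -[X in _ - X](@Normc.normc1 R).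
rewrite (le_trans (normc_dist _ _)) // (le_trans _ (H1 z zr)) //.
suff -> : map_poly (real_complex R) (\poly_(j < 1) rk_taylor M j) = 1.
  by rewrite hornerC.
apply/polyP => j; rewrite coef_map coef_poly coef1.
case: j => [|j] /=; last by rewrite rmorph0.
by rewrite (proj1 HM) // fact0 invr1 rmorph1.
Qed.

(** Here [i y] stands for the exact exponent and [d] for the error of the spatial discretization: to
    leading order the stability function at [i y + d] exceeds [cis y] by [d + e_RK (i y)^(p+1)]. *)
Lemma cis_sub_rk_stab (R : realType) (M : rk_method R) p :
  rk_order M p -> (0 < p)%N ->
  exists K r : R, [/\ 0 < K, 0 < r & forall (y : R) d, `|y| <= r -> normc d <= `|y| ->
    normc (cis y - rk_stab M (Complex 0 y + d) +
      (d + real_complex R (err_RK M p) * Complex 0 y ^+ p.+1))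
    <= K * (`|y| ^+ p.+2 + normc d * `|y|)].
Proof.
move=> HM p0.
have [K1 [r1 [K10 r10 r11 H1]]] := rk_stab_taylor M p.+2.
have HP := taylor_exp_mod HM; move: H1; set P := \poly_(j < _) _ in HP * => H1.
pose PC := map_poly (real_complex R) P.
have PE x : PC.[x] = (trunc_exp R[i] p.+2).[x] + real_complex R (err_RK M p) * x ^+ p.+1.
  have -> : PC = trunc_exp R[i] p.+2 + real_complex R (err_RK M p) *: 'X^(p.+1).
    apply/polyP => j; rewrite coef_map /= coefD coefZ coefXn !coef_poly.
    case: (ltnP j p.+2) => jp; last first.
      by rewrite [j == _]gtn_eqF // mulr0 addr0; exact: (rmorph0 (real_complex R)).
    have := HP j; rewrite coef_poly jp => -> //.
    rewrite expr1n div1r rmorphD fmorphV rmorph_nat /=.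
    by case: eqP => _; rewrite ?mulr1 ?mulr0 // (rmorph0 (real_complex R)).
  by rewrite hornerD hornerZ hornerXn.
(* As [p > 0], the perturbation in degree [p + 1] leaves the linear coefficient alone. *)
have PC1 : PC`_1 = 1.
  rewrite coef_map HP // expr1n (_ : 1`! = 1)%N // divr1 eqSS eq_sym (gtn_eqF p0) addr0.
  exact: rmorph1.
have [K2 K20 H2] := horner_linearize PC1.
(* The summands come from the remainder of [cis], the linearization of [PC], and the remainder of
   the stability function; the powers of 2 and the halved radius come from [|i y + d| <= 2 |y|]. *)
exists (2 + K2 * 2 + K1 * 2 ^+ p.+2), (r1 / 2); split.
- have : 0 < K1 * 2 ^+ p.+2 by rewrite mulr_gt0 // exprn_gt0.
  lra.
- by rewrite divr_gt0.
move=> y d yr dy.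
have ny : normc (Complex 0 y) = `|y| by rewrite /= expr0n add0r sqrtr_sqr.
have nyd : normc (Complex 0 y + d) <= 2 * `|y|.
  by rewrite (le_trans (normcD _ _)) // ny; lra.
have -> : cis y - rk_stab M (Complex 0 y + d) +
      (d + real_complex R (err_RK M p) * Complex 0 y ^+ p.+1) =
   (cis y - (trunc_exp R[i] p.+2).[Complex 0 y])
   - (PC.[Complex 0 y + d] - PC.[Complex 0 y] - d)
   - (rk_stab M (Complex 0 y + d) - PC.[Complex 0 y + d]).
  by rewrite [PC.[Complex 0 y]]PE; ring.
have A1 := cis_taylor p.+2 y.
have Y0 : 0 <= `|y| ^+ p.+2 by rewrite exprn_ge0.
have d0 := normc_ge0 d.
have y0 : 0 <= `|y| by [].
have D0 : 0 <= normc d * `|y| by rewrite mulr_ge0.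
have A2 : normc (PC.[Complex 0 y + d] - PC.[Complex 0 y] - d) <= K2 * 2 * (normc d * `|y|).
  apply: (le_trans (H2 _ _ _)); rewrite ny; first lra.
  by rewrite -mulrA ler_wpM2l ?(ltW K20) // mulrCA ler_wpM2l //; lra.
have A3 : normc (rk_stab M (Complex 0 y + d) - PC.[Complex 0 y + d])
    <= K1 * 2 ^+ p.+2 * `|y| ^+ p.+2.
  rewrite (le_trans (H1 _ _)) //; first lra.
  by rewrite -mulrA -exprMn ler_wpM2l ?(ltW K10) // lerXn2r ?nnegrE ?normc_ge0 ?mulr_ge0.
rewrite (le_trans (normcB _ _)) // (le_trans (lerD (normcB _ _) (lexx _))) //.
have C1 : 0 <= K1 * 2 ^+ p.+2 * (normc d * `|y|).
  by rewrite mulr_ge0 // mulr_ge0 ?exprn_ge0 // ltW.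
have C2 : 0 <= K2 * 2 * `|y| ^+ p.+2 by rewrite mulr_ge0 // mulr_ge0 // ltW.
move: Y0 D0 C1 C2 A1 A2 A3; set u := `|y| ^+ _; set v := normc d * _.
set k := K1 * _; set a := normc _; set b := normc _; set e := normc _.
by move=> Y0 D0 C1 C2 A1 A2 A3; rewrite !mulrDl !mulrDr; lra.
Qed.

(** * Moments and symbol of the finite-difference formula *)

Lemma ell_arr (p : nat) : odd p -> (ell p + arr p = p)%N.
Proof.
rewrite /arr /ell => op; rewrite op -[RHS]odd_double_half op.
by rewrite -uphalfE uphalf_half op /= -addnn addSn.
Qed.

Lemma prod_rev_fact (K : comNzRingType) L :
  \prod_(k < L) (L%:R - k%:R : K) = L`!%:R.
Proof.
elim: L => [|L IH]; first by rewrite big_ord0.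
rewrite big_ord_recl /= subr0 factS natrM -IH; congr (_ * _).
by apply: eq_bigr => k _; rewrite /bump /= add1n -!nat1r; ring.
Qed.

Lemma prod_oppS (K : comNzRingType) r :
  \prod_(k < r) (- k.+1%:R : K) = (-1) ^+ r * r`!%:R.
Proof.
elim: r => [|r IH]; first by rewrite big_ord0 mul1r.
by rewrite big_ord_recr /= IH factS natrM exprS; ring.
Qed.

(** Interpolation reproduces ['X^s], whose derivative at 0 vanishes unless [s = 1]. *)
Lemma fd_moment_exact (K : numFieldType) (p s : nat) : (s <= p)%N ->
  fd_deriv p 0 1 (fun j : int => (j%:~R : K) ^+ s) = (s == 1%N)%:R.
Proof.
move=> sp; rewrite (@fd_deriv_unique _ p 0 1 _ 'X^s) ?oner_neq0 ?size_polyXn //.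
  rewrite derivXn hornerMn hornerXn; case: s sp => [|[|s]] _ //=.
  by rewrite expr0n mul0rn.
by move=> k; rewrite hornerXn /fd_node add0r mulr1.
Qed.

(** The interpolant of ['X^(p+1)] is ['X^(p+1) - Q] with [Q] the monic nodal polynomial. Since 0 is
    itself a node, the derivative of [Q] at 0 is the product of the negated other nodes. *)
Lemma fd_moment_error (K : numFieldType) (p : nat) : odd p ->
  fd_deriv p 0 1 (fun j : int => (j%:~R : K) ^+ p.+1) =
  - ((-1) ^+ arr p * ((ell p)`! * (arr p)`!)%:R).
Proof.
move=> op; have p0 : (0 < p)%N by case: p op.
pose Q := \prod_(k < p.+1) ('X - (fd_node p 0 1 k : K)%:P).
have mQ : Q \is monic by exact: monic_prod_XsubC.
have sQ : size Q = p.+2 by rewrite size_prod_XsubC /index_enum -enumT size_enum_ord.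
rewrite (@fd_deriv_unique _ p 0 1 _ ('X^(p.+1) - Q)) ?oner_neq0 //; last first.
- move=> k; rewrite hornerD hornerN hornerXn horner_prod (bigD1 k) //=.
  by rewrite hornerXsubC subrr mul0r subr0 /fd_node add0r mulr1.
- apply/leq_sizeP => j; rewrite leq_eqVlt => /predU1P[<-|jp].
    by rewrite coefB coefXn eqxx; move/monicP: mQ; rewrite lead_coefE sQ /= => ->; rewrite subrr.
  by rewrite coefB coefXn gtn_eqF // nth_default ?sQ // subr0.
rewrite derivB derivXn /= hornerD hornerN hornerMn hornerXn expr0n.
rewrite eqn0Ngt p0 mul0rn sub0r; congr (- _).
(* Nodes to the left of 0, the node 0 at index [ell p], and nodes to the right. *)
have QE : Q = \prod_(k < ell p) ('X - (k%:R - (ell p)%:R)%:P) * 'X *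
    \prod_(k < arr p) ('X - (k.+1%:R)%:P).
  rewrite /Q -(big_mkord xpredT (fun k => 'X - (fd_node p 0 1 k)%:P)).
  rewrite (@big_cat_nat _ _ _ (ell p)) //=; last by rewrite -[in leqRHS](ell_arr op) leqW // leq_addr.
  rewrite [X in _ * X]big_ltn; last by rewrite -[in ltnRHS](ell_arr op) ltnS leq_addr.
  rewrite -mulrA big_mkord; congr (_ * (_ * _)).
  - apply: eq_bigr => k _; rewrite /fd_node add0r mulr1.
    by rewrite rmorphB.
  - by rewrite /fd_node subrr mul0r addr0 subr0.
  rewrite -{1}[(ell p).+1]add0n big_addn.
  have -> : (p.+1 - (ell p).+1 = arr p)%N by rewrite subSS -{1}(ell_arr op) addnC addnK.
  rewrite big_mkord; apply: eq_bigr => k _; rewrite /fd_node add0r mulr1.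
  by rewrite addnS -addSn PoszD addrK.
rewrite QE !derivM derivX mulr1 !(hornerD, hornerM, hornerX).
rewrite !mulr0 add0r mul0r addr0 !horner_prod natrM mulrCA; congr (_ * _).
  rewrite -prod_rev_fact; apply: eq_bigr => k _.
  by rewrite !(hornerD, hornerN, hornerX, hornerC) sub0r opprB.
rewrite -prod_oppS; apply: eq_bigr => k _.
by rewrite !(hornerD, hornerN, hornerX, hornerC) sub0r.
Qed.

(** Truncating the exponential at each stencil point turns the symbol into a combination of moments;
    among degrees 0 to [p + 1] only 1 and [p + 1] survive. *)
Lemma fd_symbol_expansion (R : realType) p : odd p ->
  exists2 K : R, 0 < K & forall w : R,
    normc (fd_symbol p w - (Complex 0 w -
      real_complex R (err_FD R p) * Complex 0 w ^+ p.+1)) <= K * `|w| ^+ p.+2.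
Proof.
move=> op; have p0 : (0 < p)%N by case: p op.
pose a (k : 'I_p.+1) : R[i] :=
  (tnth (p.+1.-lagrange (fd_node p 0 1)) k : {poly R[i]})^`().[0].
pose x (k : 'I_p.+1) : int := k%:Z - (ell p)%:Z.
exists (1 + \sum_k 2 * `|(x k)%:~R| ^+ p.+2 * normc (a k)) => [|w].
  rewrite ltr_pwDl // sumr_ge0 // => k _.
  by rewrite mulr_ge0 ?normc_ge0 // mulr_ge0 // exprn_ge0.
have -> : Complex 0 w - real_complex R (err_FD R p) * Complex 0 w ^+ p.+1 =
    \sum_k (trunc_exp R[i] p.+2).[Complex 0 (w * (x k)%:~R)] * a k.
  have xE k : Complex 0 (w * (x k)%:~R) = Complex 0 w * (x k)%:~R :> R[i].
    rewrite -(rmorph_int (real_complex R)); apply/eqP; rewrite eq_complex /=.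
    by apply/andP; split; apply/eqP; ring.
  transitivity (\sum_(s < p.+2) (s`!%:R)^-1 * Complex 0 w ^+ s *
      fd_deriv p 0 1 (fun j : int => (j%:~R : R[i]) ^+ s)).
    rewrite big_ord_recr /= fd_moment_error //.
    rewrite (bigD1 (Ordinal (p0 : (1 < p.+1)%N))) //= fd_moment_exact //.
    rewrite big1 => [|s s1]; last first.
      by rewrite fd_moment_exact ?(ltnSE (ltn_ord s)) // -[_ == 1%N]/(s == Ordinal (p0 : (1 < p.+1)%N)) (negPf s1) mulr0.
    rewrite /err_FD !(rmorphM, rmorphXn, fmorphV, rmorphN1, rmorph_nat) /=.
    by rewrite invr1 mulr1; ring.
  under eq_bigr => s _ do rewrite fd_derivE mulr_sumr.
  rewrite exchange_big /=; apply: eq_bigr => k _.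
  rewrite /trunc_exp /a; move: (_^`()).[0] => c.
  rewrite horner_poly mulr_suml; apply: eq_bigr => s _.
  by rewrite xE exprMn; ring.
rewrite /fd_symbol fd_derivE -sumrB (le_trans (normc_sum _ _)) //.
rewrite mulrDl mul1r mulr_suml ler_wpDl ?exprn_ge0 // ler_sum // => k _.
rewrite -mulrBl Normc.normcM mulrAC ler_wpM2r ?normc_ge0 //.
by rewrite (le_trans (cis_taylor _ _)) // normrM exprMn mulrCA mulrC mulrA.
Qed.

(** * Calculus of relative errors *)

(* [f = 1 + O(h + dt)], uniformly in [w]. *)
Definition near_one (R : realType) (dom : R -> R -> R -> Prop) (f : R -> R -> R -> R) :=
  exists K eta : R, [/\ 0 < K, 0 < eta & forall h dt w, 0 < h -> 0 < dt ->
    h + dt < eta -> dom h dt w -> `|f h dt w - 1| <= K * (h + dt)].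

Lemma near_one_mul (R : realType) (dom : R -> R -> R -> Prop) (f g : R -> R -> R -> R) :
  near_one dom f -> near_one dom g -> near_one dom (fun h dt w => f h dt w * g h dt w).
Proof.
move=> [K [eta [K0 eta0 Hf]]] [L [eps [L0 eps0 Hg]]].
(* The bound [h + dt < 1] lets the product of the two errors be absorbed into a first-order term. *)
exists (K + L + K * L), (Num.min 1 (Num.min eta eps)); split.
- by rewrite !addr_gt0 // mulr_gt0.
- by rewrite !lt_min ltr01 eta0.
move=> h dt w h0 dt0; rewrite !lt_min => /and3P[t1 teta teps] D.
have := Hf h dt w h0 dt0 teta D; have := Hg h dt w h0 dt0 teps D.
move: (f h dt w) (g h dt w) => a b.
set t := h + dt in t1 *; have t0 : 0 < t by exact: addr_gt0.
move=> Hb Ha.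
have -> : a * b - 1 = (a - 1) + (b - 1) + (a - 1) * (b - 1) by ring.
have -> : (K + L + K * L) * t = K * t + L * t + K * L * t by ring.
rewrite (le_trans (ler_normD _ _)) // lerD //.
  by rewrite (le_trans (ler_normD _ _)) // lerD.
rewrite normrM (le_trans (ler_pM _ _ Ha Hb)) // mulrACA.
rewrite ler_wpM2l ?mulr_ge0 ?(ltW K0) ?(ltW L0) //.
by rewrite ler_piMl // ltW.
Qed.

Lemma near_one_exp (R : realType) (dom : R -> R -> R -> Prop) (f : R -> R -> R -> R) n :
  near_one dom f -> near_one dom (fun h dt w => f h dt w ^+ n).
Proof.
move=> Hf; elim: n => [|n IH].
  exists 1, 1; split => // h dt w h0 dt0 _ _.
  by rewrite expr0 subrr normr0 mul1r ltW // addr_gt0.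
under eq_fun do under eq_fun do under eq_fun do rewrite exprS.
exact: near_one_mul.
Qed.

Lemma near_one_ext (R : realType) (dom : R -> R -> R -> Prop) (f g : R -> R -> R -> R) :
  (exists2 eta : R, 0 < eta & forall h dt w, 0 < h -> 0 < dt -> h + dt < eta ->
    dom h dt w -> f h dt w = g h dt w) ->
  near_one dom f -> near_one dom g.
Proof.
move=> [eps eps0 fg] [K [eta [K0 eta0 Hf]]].
exists K, (Num.min eta eps); split => //; first by rewrite lt_min eta0.
move=> h dt w h0 dt0; rewrite lt_min => /andP[teta teps] D.
by rewrite -fg // Hf.
Qed.

Lemma near_one_half (R : realType) (dom : R -> R -> R -> Prop) (f : R -> R -> R -> R) :
  near_one dom f -> exists2 eta : R, 0 < eta &
    forall h dt w, 0 < h -> 0 < dt -> h + dt < eta -> dom h dt w ->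
      2^-1 <= f h dt w <= 2.
Proof.
move=> [K [eta [K0 eta0 Hf]]].
exists (Num.min eta (2 * K)^-1) => [|h dt w h0 dt0].
  by rewrite lt_min eta0 invr_gt0 mulr_gt0.
rewrite lt_min => /andP[teta tK] D; have := Hf h dt w h0 dt0 teta D.
have : K * (h + dt) <= 2^-1.
  by rewrite -ler_pdivlMl // -invfM mulrC ltW.
by rewrite ler_norml => ? /andP[? ?]; apply/andP; split; lra.
Qed.

Lemma near_one_inv (R : realType) (dom : R -> R -> R -> Prop) (f : R -> R -> R -> R) :
  near_one dom f -> near_one dom (fun h dt w => (f h dt w)^-1).
Proof.
move=> Hf; have [eps eps0 He] := near_one_half Hf.
have [K [eta [K0 eta0 HK]]] := Hf.
exists (2 * K), (Num.min eta eps); split.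
- by rewrite mulr_gt0.
- by rewrite lt_min eta0.
move=> h dt w h0 dt0; rewrite lt_min => /andP[teta teps] D.
have := HK h dt w h0 dt0 teta D; have /andP[] := He h dt w h0 dt0 teps D.
move: (f h dt w) => a a2 _ aK.
have a0 : 0 < a by apply: lt_le_trans a2; rewrite invr_gt0.
have -> : a^-1 - 1 = - (a - 1) / a by field; rewrite gt_eqF.
rewrite normrM normrN normfV (gtr0_norm a0) ler_pdivrMr //.
have : K * (h + dt) * 2^-1 <= K * (h + dt) * a.
  by rewrite ler_wpM2l // mulr_ge0 // ltW // addr_gt0.
by lra.
Qed.

(** * Leading terms on the smooth characteristic modes *)

Section Asymptotics.
Variables (R : realType) (p m : nat) (alpha C delta : R) (fine coarse : rk_method R).
Hypotheses (hp : odd p) (hm : (1 < m)%N) (halpha : 0 < alpha) (C0 : 0 < C) (delta0 : 0 < delta).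
Hypotheses (hfine : rk_order fine p) (hcoarse : rk_order coarse p).

Let M : R := m%:R.
Let cfl (h dt : R) : R := alpha * dt / h.
Let D (h dt : R) : R := err_FD R p + (M * cfl h dt) ^+ p * err_RK coarse p.
Let A : R := err_RK fine p - M ^+ p * err_RK coarse p.
Let L (w : R) : R[i] := fd_symbol p w.
Let z (h dt w : R) : R[i] := real_complex R (- cfl h dt) * L w.
(** The CFL number is not confined to a compact range. The bound [delta] keeps the leading factor
    [D] of the denominator away from zero, which it may reach when the two error constants have
    opposite signs. *)
Let admissible (h dt w : R) : Prop :=
  [/\ w != 0, `|w| <= C * h & delta <= `|D h dt|].

Let p0 : (0 < p)%N. Proof. by case: p hp. Qed.
Let M0 : 0 < M. Proof. by rewrite ltr0n ltnW. Qed.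
Let cfl_gt0 (h dt : R) : 0 < h -> 0 < dt -> 0 < cfl h dt.
Proof. by move=> h0 dt0; rewrite divr_gt0 // mulr_gt0. Qed.

(** The phase [c |w|] is of order [dt] whatever the CFL number; the uniformity in [c] of the later
    estimates rests on this. *)
Let cflw (h dt w : R) : 0 < h -> 0 < dt -> `|w| <= C * h -> cfl h dt * `|w| <= alpha * C * dt.
Proof.
move=> h0 dt0 wC; have c0 := cfl_gt0 h0 dt0.
apply: le_trans (_ : cfl h dt * (C * h) <= _); first by rewrite ler_wpM2l // ltW.
rewrite le_eqVlt; apply/orP; left; apply/eqP; rewrite /cfl; field.
by rewrite gt_eqF.
Qed.

Lemma symbol_near : exists2 K : R, 0 < K & forall w : R, `|w| <= 1 ->
  normc (L w - Complex 0 w) <= K * `|w| ^+ p.+1.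
Proof.
have [K K0 H] := fd_symbol_expansion R hp.
exists (K + `|err_FD R p|) => [|w w1]; first by rewrite ltr_pwDl.
have nw : normc (Complex 0 w) = `|w| by rewrite /= expr0n add0r sqrtr_sqr.
have -> : L w - Complex 0 w = (L w - (Complex 0 w -
    real_complex R (err_FD R p) * Complex 0 w ^+ p.+1))
    - real_complex R (err_FD R p) * Complex 0 w ^+ p.+1 by ring.
rewrite (le_trans (normcB _ _)) // mulrDl lerD //.
  rewrite (le_trans (H w)) // ler_wpM2l ?(ltW K0) // exprS ler_piMl // exprn_ge0 //.
by rewrite Normc.normcM normcX nw normc_real.
Qed.

Lemma near_one_z : near_one admissible (fun h dt w => normc (z h dt w) / (cfl h dt * `|w|)).
Proof.
have [K K0 H] := symbol_near.
exists (K * C), C^-1; split.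
- exact: mulr_gt0.
- by rewrite invr_gt0.
move=> h dt w h0 dt0 ht [w0 wC _].
have w1 : `|w| <= 1.
  rewrite (le_trans wC) // mulrC -ler_pdivlMr // div1r ltW //.
  by apply: le_lt_trans ht; rewrite lerDl ltW.
have c0 := cfl_gt0 h0 dt0.
have w0' : 0 < `|w| by rewrite normr_gt0.
have nw : normc (Complex 0 w) = `|w| by rewrite /= expr0n add0r sqrtr_sqr.
rewrite /z Normc.normcM normc_real normrN (gtr0_norm c0).
have -> : cfl h dt * normc (L w) / (cfl h dt * `|w|) - 1 = (normc (L w) - `|w|) / `|w|.
  by field; rewrite !gt_eqF.
rewrite normrM normfV normr_id ler_pdivrMr // -{1}nw.
rewrite (le_trans (normc_dist _ _)) // (le_trans (H w w1)) //.
rewrite -!mulrA ler_wpM2l ?(ltW K0) // exprSr mulrA ler_wpM2r //.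
apply: le_trans (_ : C * h <= _); last by rewrite ler_wpM2l ?(ltW C0) // lerDl ltW.
apply: le_trans wC; rewrite -(prednK p0) exprS ler_piMr // exprn_ile1 //.
Qed.

Lemma z_small : exists K eta : R, [/\ 0 < K, 0 < eta & forall h dt w, 0 < h -> 0 < dt ->
  h + dt < eta -> admissible h dt w -> 0 < normc (z h dt w) <= K * (h + dt)].
Proof.
have [eta eta0 H] := near_one_half near_one_z.
have aC0 : 0 < alpha * C by rewrite mulr_gt0.
exists (2 * (alpha * C)), eta; split => //; first by rewrite mulr_gt0.
move=> h dt w h0 dt0 ht adm; have := H h dt w h0 dt0 ht adm; case: adm => w0 wC _.
have cw0 : 0 < cfl h dt * `|w| by rewrite mulr_gt0 ?normr_gt0 ?cfl_gt0.
rewrite ler_pdivlMr // ler_pdivrMr // => /andP[zl zu]; apply/andP; split.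
  by apply: lt_le_trans zl; rewrite mulr_gt0 // invr_gt0.
rewrite (le_trans zu) // -mulrA ler_wpM2l // (le_trans (cflw h0 dt0 wC)) //.
by rewrite ler_wpM2l ?(ltW aC0) // lerDr ltW.
Qed.

(** Each relaxation factor tends to 1, so the leading term does not depend on [nu]. *)
Lemma near_one_fine : near_one admissible (fun h dt w => normc (rk_stab fine (z h dt w))).
Proof.
have [K [r [K0 r0 _ H]]] := rk_stab_near1 hfine.
have [K' [eta [K'0 eta0 Hz]]] := z_small.
exists (K * K'), (Num.min eta (r / K')); split.
- exact: mulr_gt0.
- by rewrite lt_min eta0 divr_gt0.
move=> h dt w h0 dt0; rewrite lt_min => /andP[ht hr] adm.
have /andP[_ zK] := Hz h dt w h0 dt0 ht adm.
rewrite (le_trans (H _ _)) //; last by rewrite -mulrA ler_wpM2l ?(ltW K0).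
by rewrite (le_trans zK) // -ler_pdivlMl // mulrC ltW.
Qed.

(** The difference is first normalized by the power [p + 1] of [|z|], and [|z|] is then exchanged
    for [c |w|] by means of [near_one_z]. *)
Lemma near_one_num : A != 0 -> near_one admissible (fun h dt w =>
  normc (rk_stab fine (z h dt w) ^+ m - rk_stab coarse (m%:R * z h dt w)) /
  (M * `|A| * (cfl h dt * `|w|) ^+ p.+1)).
Proof.
move=> A0; have A0' : 0 < `|A| by rewrite normr_gt0.
have MA0 : 0 < M * `|A| by rewrite mulr_gt0.
have [K [r [K0 r0 _ H]]] := rk_stab_power_diff hfine hcoarse (ltnW hm).
have [K' [eta [K'0 eta0 Hz]]] := z_small.
have near_z : near_one admissible (fun h dt w =>
    normc (rk_stab fine (z h dt w) ^+ m - rk_stab coarse (m%:R * z h dt w)) /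
    (M * `|A| * normc (z h dt w) ^+ p.+1)).
  exists (K * K' / (M * `|A|)), (Num.min eta (r / K')); split.
  - by rewrite divr_gt0 // mulr_gt0.
  - by rewrite lt_min eta0 divr_gt0.
  move=> h dt w h0 dt0; rewrite lt_min => /andP[ht hr] adm.
  have /andP[z0 zK] := Hz h dt w h0 dt0 ht adm.
  have zr : normc (z h dt w) <= r.
    by rewrite (le_trans zK) // -ler_pdivlMl // mulrC ltW.
  have := H _ zr; move: z0 zK {zr}; set u := normc (z h dt w) => u0 uK.
  rewrite -/M -/A => HH.
  have up0 : 0 < u ^+ p.+1 by exact: exprn_gt0.
  have den0 : 0 < M * `|A| * u ^+ p.+1 by exact: mulr_gt0.
  rewrite -[X in _ - X](divff (lt0r_neq0 den0)) -mulrBl normrM normfV (gtr0_norm den0).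
  rewrite ler_pdivrMr //.
  have -> : K * K' / (M * `|A|) * (h + dt) * (M * `|A| * u ^+ p.+1) =
      K * (K' * (h + dt)) * u ^+ p.+1 by field; rewrite !gt_eqF.
  have -> : M * `|A| * u ^+ p.+1 =
      normc (real_complex R (M * A) * z h dt w ^+ p.+1).
    by rewrite Normc.normcM normc_real normcX normrM (gtr0_norm M0).
  rewrite (le_trans (normc_dist _ _)) // (le_trans HH) // exprS [leLHS]mulrA.
  by rewrite ler_wpM2r ?(ltW up0) // ler_wpM2l // ltW.
have := near_one_mul near_z (near_one_exp p.+1 near_one_z).
apply: near_one_ext; exists eta => // h dt w h0 dt0 ht adm.
have /andP[z0 _] := Hz h dt w h0 dt0 ht adm; case: adm => w0 _ _.
have c0 := cfl_gt0 h0 dt0.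
have cw0 : 0 < cfl h dt * `|w| by rewrite mulr_gt0 ?normr_gt0.
have := exprn_gt0 p.+1 z0; have := exprn_gt0 p.+1 cw0; rewrite (expr_div_n (normc _)).
move: (_ ^+ p.+1) (normc (z h dt w) ^+ p.+1) => a b a0 b0; field.
by rewrite !gt_eqF.
Qed.

Let denom (h dt w : R) : R[i] :=
  1 - cis (- (m%:R * - (w * alpha * dt / h))) * rk_stab coarse (m%:R * z h dt w).

(* On the characteristic [theta = - w alpha dt / h] the denominator measures the defect of
   [mu] with respect to the exact coarse propagator [cis (- m c w)]. *)
Lemma denom_norm (h dt w : R) :
  normc (denom h dt w) =
  normc (cis (- (M * cfl h dt * w)) - rk_stab coarse (m%:R * z h dt w)).
Proof.
have E : - (m%:R * - (w * alpha * dt / h)) = M * cfl h dt * w.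
  by rewrite /M /cfl; ring.
rewrite /denom E; move: (M * _ * w) (rk_stab _ _) => t mu.
rewrite -[LHS]mul1r -(normc_cis (- t)) -Normc.normcM.
rewrite mulrBr mulr1 mulrA -cisD addNr; congr (normc (_ - _)).
by rewrite /cis cos0 sin0 -[RHS]mul1r.
Qed.

(** The spatial defect and the coarse Runge-Kutta error both enter at order [|w|^(p+1)], and for odd
    [p] they add up to [D] times a common factor. Every remainder is compared with [|D|], either
    through [delta] or, when it carries [c^p], through [q]. *)
Lemma near_one_den : near_one admissible (fun h dt w =>
  normc (denom h dt w) / (M * cfl h dt * `|w| ^+ p.+1 * `|D h dt|)).
Proof.
set eF := err_FD R p; set eC := err_RK coarse p.
have eC0 : 0 < `|eC|.
  by rewrite normr_gt0 subr_eq0; apply/eqP; exact: hcoarse.2.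
have [K1 K10 H1] := fd_symbol_expansion R hp.
have [K2 K20 H2] := symbol_near.
have [K3 [r [K30 r0 H3]]] := cis_sub_rk_stab hcoarse p0.
(* Chosen so that [(M c)^p <= q |D|]: indeed [(M c)^p |eC| = |D - eF|], and
   [|eF| <= |eF| |D| / delta]. *)
pose q := (1 + `|eF| / delta) / `|eC|.
have q0 : 0 < q by rewrite divr_gt0 // ltr_pwDl // divr_ge0 // ltW.
have aC0 : 0 < alpha * C by exact: mulr_gt0.
pose K := K1 * C / delta + K3 * (q + K2 / delta) * (M * (alpha * C)).
(* The three thresholds ensure in turn [|w| <= 1], then [K2 |w| <= 1] and hence [|d| <= |y|], and
   finally [|y| <= r]. *)
exists K, (Num.min C^-1 (Num.min (K2 * C)^-1 (r / (M * (alpha * C))))); split.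
- by rewrite addr_gt0 // ?divr_gt0 ?mulr_gt0 // addr_gt0 // divr_gt0.
- by rewrite !lt_min !invr_gt0 C0 mulr_gt0 // divr_gt0 // mulr_gt0.
move=> h dt w h0 dt0; rewrite !lt_min => /and3P[t1 t2 t3] [w0 wC DD].
have w0' : 0 < `|w| by rewrite normr_gt0.
have ht : h <= h + dt by rewrite lerDl ltW.
have dtt : dt <= h + dt by rewrite lerDr ltW.
have w1 : `|w| <= 1.
  by rewrite (le_trans wC) // mulrC -ler_pdivlMr // div1r (le_trans ht) // ltW.
have w2 : K2 * `|w| <= 1.
  rewrite (le_trans (ler_wpM2l (ltW K20) wC)) // mulrA mulrC -ler_pdivlMr ?mulr_gt0 //.
  by rewrite div1r (le_trans ht) // ltW.
have c0 := cfl_gt0 h0 dt0.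
have cw := cflw h0 dt0 wC.
have zE : z h dt w = real_complex R (- cfl h dt) * L w by [].
have DE : D h dt = eF + (M * cfl h dt) ^+ p * eC by [].
rewrite denom_norm; move: c0 cw zE DE; move: (cfl h dt) => c c0 cw zE DE.
have {}H1 := H1 w; have {}H2 := H2 w w1.
(* [y] is the phase of the exact coarse propagator, and [d] the spatial error in the coarse
   argument. *)
pose y := - (M * c * w).
pose d := m%:R * z h dt w - Complex 0 y.
have Mc0 : 0 < M * c by exact: mulr_gt0.
have ny : `|y| = M * c * `|w| by rewrite normrN normrM (gtr0_norm Mc0).
have yE : Complex 0 y = - (real_complex R (M * c) * Complex 0 w).
  by apply/eqP; rewrite eq_complex /=; apply/andP; split; apply/eqP; rewrite /y; ring.
have dE : d = - (real_complex R (M * c) * (L w - Complex 0 w)).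
  by rewrite /d yE zE rmorphN (rmorphM _ M c) /M rmorph_nat; ring.
have nw : normc (Complex 0 w) = `|w| by rewrite /= expr0n add0r sqrtr_sqr.
pose W := M * c * `|w| ^+ p.+1.
have W0 : 0 < W by rewrite mulr_gt0 // exprn_gt0.
have nd : normc d <= K2 * W.
  rewrite dE normcN Normc.normcM normc_real (gtr0_norm Mc0) /W mulrCA.
  by rewrite ler_wpM2l // ltW.
have dy : normc d <= `|y|.
  rewrite (le_trans nd) // ny /W mulrCA ler_wpM2l ?(ltW Mc0) // exprSr mulrA.
  rewrite ler_piMl // (le_trans _ w2) // ler_wpM2l ?(ltW K20) //.
  by rewrite -(prednK p0) exprS ler_piMr // exprn_ile1.
have yt : `|y| <= M * (alpha * C) * (h + dt).
  rewrite ny -!mulrA ler_wpM2l ?(ltW M0) // (le_trans cw) // -mulrA.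
  by rewrite !ler_wpM2l // ltW.
have yr : `|y| <= r.
  by rewrite (le_trans yt) // -ler_pdivlMl ?mulr_gt0 // mulrC ltW.
have {H3} := H3 y d yr dy.
have -> : Complex 0 y + d = m%:R * z h dt w by rewrite /d; ring.
rewrite -/y -/eC; set X := cis y - _.
pose main := real_complex R (M * c * D h dt) * Complex 0 w ^+ p.+1.
have nmain : normc main = W * `|D h dt|.
  by rewrite Normc.normcM normcX nw normc_real normrM (gtr0_norm Mc0) mulrAC.
(* Parity enters here: [p + 1] is even, so [(i y)^(p+1)] equals [(M c)^(p+1) (i w)^(p+1)] with a
   plus sign. *)
have -> : d + real_complex R eC * Complex 0 y ^+ p.+1 = main -
    real_complex R (M * c) * (L w - (Complex 0 w -
      real_complex R (err_FD R p) * Complex 0 w ^+ p.+1)).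
  rewrite dE yE exprNn -signr_odd /= hp expr0 mul1r exprMn /main DE -/eF.
  move: (M * c) (eC) (eF) => k a b.
  by rewrite !(rmorphM, rmorphD, rmorphXn) /= [k%:C%C ^+ p.+1]exprS; ring.
move=> HX; set T := real_complex R _ * (L w - _) in HX.
have nT : normc T <= K1 * `|w| * W.
  rewrite Normc.normcM normc_real (gtr0_norm Mc0) /W.
  have -> : K1 * `|w| * (M * c * `|w| ^+ p.+1) =
    M * c * (K1 * `|w| ^+ p.+2) by rewrite [in RHS]exprS; ring.
  by rewrite ler_wpM2l // ltW.
have D0 : 0 < `|D h dt| by exact: lt_le_trans DD.
have N0 : 0 < W * `|D h dt| by exact: mulr_gt0.
have Mcp : (M * c) ^+ p <= q * `|D h dt|.
  rewrite /q mulrAC ler_pdivlMr //.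
  have -> : (M * c) ^+ p * `|eC| = `|D h dt - eF|.
    by rewrite DE addrAC subrr add0r normrM normrX (gtr0_norm Mc0).
  rewrite (le_trans (ler_normB _ _)) // mulrDl mul1r lerD2l.
  by rewrite mulrAC ler_pdivlMr // ler_wpM2l.
(* Remainders that carry no factor [c^p] are multiplied by this quantity to be compared with
   [|D|]. *)
have invD : 1 <= `|D h dt| / delta by rewrite ler_pdivlMr // mul1r.
rewrite -/W -[X in _ - X](divff (lt0r_neq0 N0)) -mulrBl normrM normfV (gtr0_norm N0).
rewrite ler_pdivrMr // -nmain -[normc main]normcN.
rewrite (le_trans (normc_dist _ _)) // opprK.
have -> : X + main = (X + (main - T)) + T by ring.
rewrite (le_trans (normcD _ _)) // (le_trans (lerD HX nT)) // normcN nmain.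
set s := M * (alpha * C) * (h + dt) in yt.
have E : K * (h + dt) * (W * `|D h dt|) =
    K3 * (q * `|D h dt| * W * s + K2 * W * s * (`|D h dt| / delta)) +
    K1 * (C * (h + dt)) * W * (`|D h dt| / delta) by rewrite /K /s; ring.
have s0 : 0 <= s by apply: le_trans yt.
rewrite E lerD //; last first.
  rewrite -[leLHS]mulr1 ler_pM ?(mulr_ge0 (mulr_ge0 (ltW K10) _) (ltW W0)) //.
  rewrite ler_wpM2r ?(ltW W0) // ler_wpM2l ?(ltW K10) // (le_trans wC) //.
  by rewrite ler_wpM2l // ltW.
rewrite ler_wpM2l ?(ltW K30) // lerD //.
  have -> : `|y| ^+ p.+2 = (M * c) ^+ p * W * `|y|.
    by rewrite exprSr ny exprMn [(M * c) ^+ p.+1]exprSr /W; ring.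
  by rewrite ler_pM ?(mulr_ge0 _ (ltW W0)) ?exprn_ge0 ?(ltW Mc0) // ler_wpM2r // ltW.
apply: le_trans (_ : K2 * W * s <= _).
  by rewrite ler_pM ?normc_ge0.
by rewrite ler_peMr // mulr_ge0 // mulr_ge0 ?(ltW K20) ?(ltW W0).
Qed.

(** The leading parts of numerator and denominator have quotient [rho_check]: [|w|^(p+1)], [M] and
    one factor [c] cancel. The relaxation factor only contributes to the relative error. *)
Lemma rho_mode_expansion (nu : nat) : A != 0 ->
  exists K eta : R, [/\ 0 < K, 0 < eta & forall h dt w, 0 < h -> 0 < dt ->
    h + dt < eta -> admissible h dt w ->
    exists e : R, rho_mode p m nu fine coarse alpha dt h w (- (w * alpha * dt / h))
        = (rho_check p m fine coarse (cfl h dt) * (1 + e))%:E /\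
      `|e| <= K * (h + dt)].
Proof.
move=> A0.
have Hden := near_one_den; have [eps eps0 Heps] := near_one_half Hden.
have [K [eta [K0 eta0 H]]] := near_one_mul (near_one_exp (m * nu) near_one_fine)
  (near_one_mul (near_one_num A0) (near_one_inv Hden)).
exists K, (Num.min eta eps); split => //; first by rewrite lt_min eta0.
move=> h dt w h0 dt0; rewrite lt_min => /andP[teta teps] adm.
have := H h dt w h0 dt0 teta adm.
have /andP[] := Heps h dt w h0 dt0 teps adm.
have E : real_complex R (- (alpha * (m%:R * dt) / h)) * fd_symbol p w = m%:R * z h dt w.
  rewrite /z mulrA; congr (_ * _); rewrite -(rmorph_nat (real_complex R)) -rmorphM.
  by congr (real_complex R _); rewrite /cfl; ring.
rewrite /rho_mode /mol_symbol E !Re_norm -/(denom h dt w) -/(cfl h dt) -/(L w) -/(z h dt w).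
case: adm => w0 _ DD.
have D0 : D h dt != 0 by rewrite -normr_gt0 (lt_le_trans _ DD).
have c0 := cfl_gt0 h0 dt0.
have W0 : 0 < `|w| by rewrite normr_gt0.
set a := normc (rk_stab _ _) ^+ _; set d := normc (1 - _); set b := normc _.
set f := a * _ => d2 _ Hf.
(* Positivity makes the extended-real inverse of the denominator the ordinary one. *)
have d0 : 0 < d.
  have : 0 < d / (M * cfl h dt * `|w| ^+ p.+1 * `|D h dt|).
    by apply: lt_le_trans d2; rewrite invr_gt0.
  by rewrite pmulr_lgt0 // invr_gt0 mulr_gt0 ?normr_gt0 // mulr_gt0 ?exprn_gt0 // mulr_gt0.
exists (f - 1); split => //; rewrite inver (gt_eqF d0) -EFinM; congr EFin.
rewrite addrC subrK /rho_check -/M -/A -/(D h dt) normrM normfV /f [(cfl h dt * `|w|) ^+ _]exprMn.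
move: D0 A0 (exprn_gt0 p.+1 W0); rewrite -!normr_gt0 [cfl _ _ ^+ p.+1]exprS.
move: (exprn_gt0 p c0) (`|w| ^+ _) (`|A|) (`|D h dt|).
move: (cfl h dt ^+ p) => k k0 x y t t0 y0 x0.
by field; rewrite !gt_eqF.
Qed.
End Asymptotics.

(** * The function [rho_check] for large and small CFL numbers *)

Lemma err_FD_neq0 (R : realType) p : err_FD R p != 0.
Proof.
by rewrite /err_FD !mulf_neq0 ?invr_eq0 ?signr_eq0 ?pnatr_eq0 -?lt0n ?muln_gt0 ?fact_gt0.
Qed.

(** With [X = (m c)^p], the limit is [|A| / (m^p |E|)]. The deviation has a numerator controlled by
    [| X |E| - |F + X E| | <= |F|], while [|F + X E| >= X |E| / 2] for large [c]. *)
Lemma rho_check_large (R : realType) (p m : nat) (fine coarse : rk_method R) :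
  (0 < p)%N -> (0 < m)%N -> err_RK coarse p != 0 ->
  exists2 K : R, 0 < K & \forall c \near +oo,
    `|rho_check p m fine coarse c
      - `|1 - (m%:R ^+ p)^-1 * (err_RK fine p / err_RK coarse p)| |
    <= K * `|1 / (m%:R * c) ^+ p|.
Proof.
move=> p0 m0 E0; rewrite /rho_check.
move: (err_FD_neq0 R p) E0; set F := err_FD R p; set E := err_RK coarse p; set e := err_RK fine p.
move=> F0 E0; have M0 : 0 < m%:R :> R by rewrite ltr0n.
have Mp0 : 0 < m%:R ^+ p :> R by rewrite exprn_gt0.
set A := e - m%:R ^+ p * E.
(* The added 1 keeps the constant positive when [A] vanishes. *)
exists (2 * `|A| * `|F| / (m%:R ^+ p * `|E| ^+ 2) + 1).
  by rewrite ltr_wpDl // divr_ge0 // !mulr_ge0 // ?exprn_ge0 // ltW.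
near=> c.
have c1 : 1 <= m%:R * c by rewrite mulrC -ler_pdivrMr // div1r; near: c; exact: nbhs_pinfty_ge (num_real _).
have X1 : 2 * `|F| / `|E| <= (m%:R * c) ^+ p.
  apply: le_trans (_ : m%:R * c <= _).
    by rewrite [leRHS]mulrC -ler_pdivrMr //; near: c; exact: nbhs_pinfty_ge (num_real _).
  by rewrite -(prednK p0) exprS ler_peMr ?exprn_ege1 // (le_trans ler01).
have c0 : 0 < c by rewrite -(pmulr_rgt0 _ M0) (lt_le_trans ltr01).
set X := (m%:R * c) ^+ p in X1 *.
have X0 : 0 < X by rewrite exprn_gt0 // mulr_gt0.
have cX : c ^+ p = X / m%:R ^+ p by rewrite /X exprMn; field; rewrite gt_eqF.
have E0' : 0 < `|E| by rewrite normr_gt0.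
rewrite ler_pdivrMr // in X1.
have D0 : X * `|E| <= 2 * `|F + X * E|.
  have := ler_normB (F + X * E) F; rewrite addrAC subrr add0r normrM (gtr0_norm X0).
  lra.
have XE0 : 0 < X * `|E| by exact: mulr_gt0.
have D0' : 0 < `|F + X * E| by lra.
have -> : 1 - (m%:R ^+ p)^-1 * (e / E) = - A / (m%:R ^+ p * E).
  by rewrite /A; field; rewrite E0 gt_eqF.
rewrite [`|A / _|]normrM normfV cX.
rewrite [`|- A / _|]normrM normfV normrN [`|_ * E|]normrM (gtr0_norm Mp0).
have -> : X / m%:R ^+ p * (`|A| / `|F + X * E|) - `|A| / (m%:R ^+ p * `|E|) =
    `|A| / m%:R ^+ p * (X * `|E| - `|F + X * E|) / (`|F + X * E| * `|E|).
  by field; rewrite !gt_eqF.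
rewrite div1r normfV (gtr0_norm X0).
have XF : `|X * `|E| - `|F + X * E| | <= `|F|.
  have -> : X * `|E| = `|X * E| by rewrite normrM (gtr0_norm X0).
  by rewrite distrC (le_trans (ler_dist_dist _ _)) // addrK.
rewrite normrM normrM [`| `|A| / _|]ger0_norm ?divr_ge0 ?(ltW Mp0) //.
rewrite [`|_^-1|]gtr0_norm ?invr_gt0 ?mulr_gt0 // ler_pdivrMr ?mulr_gt0 //.
apply: le_trans (_ : `|A| / m%:R ^+ p * `|F| <= _).
  by rewrite ler_wpM2l // divr_ge0 // ltW.
have -> : `|A| / m%:R ^+ p * `|F| = 2 * `|A| * `|F| / (m%:R ^+ p * `|E| ^+ 2) / X *
    (X * `|E| / 2 * `|E|) by field; rewrite !gt_eqF.
have K0 : 0 <= 2 * `|A| * `|F| / (m%:R ^+ p * `|E| ^+ 2).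
  by rewrite divr_ge0 // !mulr_ge0 // ?exprn_ge0 // ltW.
rewrite ler_pM //.
- by rewrite divr_ge0 // ltW.
- by rewrite !mulr_ge0 // ltW.
- by rewrite ler_wpM2r ?invr_ge0 ?(ltW X0) // lerDl.
- by rewrite ler_wpM2r //; lra.
Unshelve. all: by end_near. Qed.

(** For small [c] the denominator is at least [|F| / 2], and [c^p] is a constant multiple of
    [(m c)^p]. *)
Lemma rho_check_small (R : realType) (p m : nat) (fine coarse : rk_method R) :
  (0 < p)%N -> (0 < m)%N ->
  exists2 K : R, 0 < K & \forall c \near 0^'+,
    `|rho_check p m fine coarse c| <= K * `|(m%:R * c) ^+ p|.
Proof.
move=> p0 m0; rewrite /rho_check.
move: (err_FD_neq0 R p); set F := err_FD R p; set E := err_RK coarse p.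
set A := _ - _ => F0; have M0 : 0 < m%:R :> R by rewrite ltr0n.
have Mp0 : 0 < m%:R ^+ p :> R by rewrite exprn_gt0.
have F0' : 0 < `|F| by rewrite normr_gt0.
exists (2 * `|A| / (m%:R ^+ p * `|F|) + 1).
  by rewrite ltr_wpDl // divr_ge0 // !mulr_ge0 // ?exprn_ge0 // ltW.
near=> c.
have c0 : 0 < c by near: c; exact: nbhs_right_gt.
have mc0 : 0 < m%:R * c by exact: mulr_gt0.
have c1 : m%:R * c <= 1.
  rewrite mulrC -ler_pdivlMr //; near: c; apply: nbhs_right_le.
  by rewrite divr_gt0.
(* Adding 1 to [|E|] keeps the divisor positive even if [E] is zero. *)
have c2 : m%:R * c * (2 * (`|E| + 1)) <= `|F|.
  rewrite -ler_pdivlMr ?mulr_gt0 ?ltr_wpDl // mulrC -ler_pdivlMr //.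
  by near: c; apply: nbhs_right_le; rewrite !divr_gt0 ?mulr_gt0 ?ltr_wpDl.
set X := (m%:R * c) ^+ p.
have X0 : 0 < X by rewrite exprn_gt0.
have Xc : X <= m%:R * c.
  by rewrite /X -(prednK p0) exprS ler_piMr ?(ltW mc0) // exprn_ile1 // ltW.
have XE : 2 * (X * `|E|) <= `|F|.
  have : X * `|E| <= m%:R * c * (`|E| + 1).
    by rewrite ler_pM ?(ltW X0) // lerDl.
  lra.
have D0 : `|F| <= 2 * `|F + X * E|.
  have := ler_normB (F + X * E) (X * E); rewrite addrK [`|X * E|]normrM (gtr0_norm X0).
  lra.
have D0' : 0 < `|F + X * E| by lra.
have cX : c ^+ p = X / m%:R ^+ p by rewrite /X exprMn; field; rewrite gt_eqF.
rewrite normrM normr_id (gtr0_norm X0) normrM normfV cX.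
rewrite ger0_norm ?divr_ge0 ?(ltW X0) ?(ltW Mp0) //.
apply: le_trans (_ : X / m%:R ^+ p * (`|A| * (2 / `|F|)) <= _).
  rewrite !ler_wpM2l ?divr_ge0 ?(ltW X0) ?(ltW Mp0) //.
  by rewrite ler_pdivlMr // mulrC ler_pdivrMr.
have -> : X / m%:R ^+ p * (`|A| * (2 / `|F|)) = 2 * `|A| / (m%:R ^+ p * `|F|) * X.
  by field; rewrite !gt_eqF.
by rewrite [leRHS]mulrDl lerDl mul1r ltW.
Unshelve. all: by end_near. Qed.

Theorem theorem1 (R : realType) (p m nu : nat) (alpha : R)
    (fine coarse : rk_method R)
    (hp : odd p) (hm : (1 < m)%N) (halpha : 0 < alpha)
    (hfine : rk_explicit fine \/ (rk_sdirk fine /\ rk_A_stable fine))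
    (hcoarse : rk_explicit coarse \/ (rk_sdirk coarse /\ rk_A_stable coarse))
    (hfine_order : rk_order fine p) (hcoarse_order : rk_order coarse p) :
  (forall C delta : R, 0 < C -> 0 < delta ->
    exists K eta : R, 0 < eta /\
      forall (n : nat) (dt w : R),
        let h := mesh_width R n in
        let c := alpha * dt / h in
        let theta := - (w * alpha * dt / h) in
        h < eta -> 0 < dt -> dt < eta -> w != 0 -> `|w| <= C * h ->
        (rho_mode p m nu fine coarse alpha dt h w theta
           <= rho_E p m nu fine coarse alpha dt h)%E /\
        (err_RK fine p != m%:R ^+ p * err_RK coarse p ->
         delta <= `|err_FD R p + (m%:R * c) ^+ p * err_RK coarse p| ->
         exists e : R,
           rho_mode p m nu fine coarse alpha dt h w theta
             = (rho_check p m fine coarse c * (1 + e))%:E /\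
           `|e| <= K * (h + dt + dt * (dt / h) ^+ p
                          + dt * (dt / h) ^+ p.+1)))
  /\ (exists2 K : R, 0 < K & \forall c \near +oo,
        `|rho_check p m fine coarse c
          - `|1 - (m%:R ^+ p)^-1 * (err_RK fine p / err_RK coarse p)| |
        <= K * `|1 / (m%:R * c) ^+ p|)
  /\ (exists2 K : R, 0 < K & \forall c \near 0^'+,
        `|rho_check p m fine coarse c| <= K * `|(m%:R * c) ^+ p|).

Proof.
have p0 : (0 < p)%N by case: (p) hp.
have m0 : (0 < m)%N by exact: ltnW.
have eC0 : err_RK coarse p != 0 by rewrite subr_eq0; apply/eqP; exact: hcoarse_order.2.
split; last by split; [exact: rho_check_large | exact: rho_check_small].
move=> C delta C0 delta0.
have aC0 : 0 < alpha * C by exact: mulr_gt0.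
have [K [eps [K0 eps0 HK]]] : exists K eps : R, [/\ 0 < K, 0 < eps &
    err_RK fine p != m%:R ^+ p * err_RK coarse p ->
    forall h dt w, 0 < h -> 0 < dt -> h + dt < eps ->
    [/\ w != 0, `|w| <= C * h & delta <= `|err_FD R p +
      (m%:R * (alpha * dt / h)) ^+ p * err_RK coarse p| ] ->
    exists e : R, rho_mode p m nu fine coarse alpha dt h w (- (w * alpha * dt / h))
        = (rho_check p m fine coarse (alpha * dt / h) * (1 + e))%:E /\
      `|e| <= K * (h + dt)].
  (* Equal scaled error constants contradict the premise, so any constants serve; otherwise [A] is
     nonzero and the expansion applies. *)
  have [eq_err|A0] := eqVneq (err_RK fine p) (m%:R ^+ p * err_RK coarse p).
    by exists 1, 1; split.
  have := rho_mode_expansion hp hm halpha C0 delta0 hfine_order hcoarse_order nu.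
  rewrite subr_eq0 => /(_ A0)[K [eps [K0 eps0 HK]]].
  by exists K, eps; split => // _; exact: HK.
have piM : 0 < pi / m%:R :> R by rewrite divr_gt0 ?pi_gt0 ?ltr0n.
(* The first threshold gives [h + dt < eps]; the other two place [w] in the frequency range and
   [theta] in the low-frequency range, strictly inside, so that the half-open ends cause no
   trouble. *)
exists K, (Num.min (eps / 2) (Num.min (pi / C) (pi / m%:R / (alpha * C)))); split.
  by rewrite !lt_min (divr_gt0 eps0) // (divr_gt0 (pi_gt0 R) C0) (divr_gt0 piM aC0).
move=> n dt w h c theta; rewrite !lt_min => /and3P[h1 h2 _] dt0 /and3P[t1 _ t3] w0 wC.
have h0 : 0 < h by rewrite divr_gt0 ?ltr0n.
split.
  have half_open (x a : R) : `|x| < a -> - a <= x < a.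
    by rewrite ltr_norml => /andP[/ltW -> ->].
  apply: ereal_sup_ubound; exists w, theta; split => //; apply: half_open.
    by rewrite (le_lt_trans wC) // mulrC -ltr_pdivlMr.
  rewrite normrN !normrM normfV (gtr0_norm halpha) (gtr0_norm dt0) (gtr0_norm h0).
  rewrite (le_lt_trans (_ : _ <= alpha * C * dt)) //; last first.
    by rewrite mulrC -ltr_pdivlMr.
  have -> : `|w| * alpha * dt / h = alpha * dt / h * `|w| by ring.
  have -> : alpha * C * dt = alpha * dt / h * (C * h) by field; rewrite gt_eqF.
  by rewrite ler_wpM2l // divr_ge0 ?mulr_ge0 // ltW.
move=> A0 Ddelta.
have [|e [E eK]] := HK A0 h dt w h0 dt0 _ (And3 w0 wC Ddelta); first lra.
exists e; split=> //; rewrite (le_trans eK) // ler_wpM2l ?(ltW K0) //.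
(* The remaining two terms of the stated error are nonnegative, so the bound by [h + dt]
   suffices. *)
have dth : 0 <= dt / h by rewrite divr_ge0 // ltW.
have := mulr_ge0 (ltW dt0) (exprn_ge0 p dth).
have := mulr_ge0 (ltW dt0) (exprn_ge0 p.+1 dth).
lra.
Qed.
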